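(* Assume the cocycle $\sigma$ has the exponential moment property and is centered, and that the strong approximation property holds. Fix $\alpha>0$, $\beta>0$ and $B\ge1$. Then there exists a constant $c>0$ such that for every $t\in\mathbb R$ and $n\ge1$, and every sequence $\mathfrak f=(f_n)_{n\ge0}$ of measurable functions on $\Omega\times\mathbb X$ with $C_\alpha(\mathfrak f)\le B$ and $D_{\alpha,\beta}(\mathfrak f)\le B$, \[\int_{\mathbb X}\mathbb P\big(\tau^{\mathfrak f}_{x,t}>n\big)\nu(dx)\le c\,\frac{1+\max\{t,0\}}{\sqrt n}.\]
   Context: $\mathbb G$ is a second countable locally compact group, $\mu$ a Borel probability measure on $\mathbb G$; $\Omega=\mathbb G^{\mathbb N^*}$ with $\mathbb P=\mu^{\otimes\mathbb N^*}$, coordinates $\omega=(g_1,g_2,\dots)$. $\mathbb X$ is a second countable locally compact space with a continuous $\mathbb G$-action, $\nu$ a $\mu$-stationary Borel probability measure on $\mathbb X$. $\sigma:\mathbb G\times\mathbb X\to\mathbb R$ is a continuous cocycle ($\sigma(g_2g_1,x)=\sigma(g_2,g_1x)+\sigma(g_1,x)$) with exponential moment $\int e^{\alpha'\sup_x|\sigma(g,x)|}\mu(dg)<\infty$ for some $\alpha'>0$, and centered: $\int\sigma(g,x)\mu(dg)=0$ for all $x$. $S^x_n=\sigma(g_n\cdots g_1,x)$. Strong approximation property: on a (possibly enlarged) probability space there exist a standard Wiener process $(B_t)$ and $\mathbf v>0$ such that for each $\epsilon\in(0,\frac14)$ there is $c_\epsilon$ with $\mathbb P(\sup_{0\le s\le1}|S^x_{[ns]}-\mathbf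 vB_{ns}|>n^{1/2-\epsilon})\le c_\epsilon n^{-\epsilon}$ for all $x,n$. $T(\omega,x)=((g_{i+1})_{i\ge1},g_1x)$. For measurable $f_n:\Omega\times\mathbb X\to\mathbb R$: $C_\alpha(\mathfrak f)=\sup_n\int\int e^{\alpha|f_n|}d\mathbb P\,d\nu$; $\mathscr A_p=\sigma(g_1,\dots,g_p)$; $D_{\alpha,\beta}(\mathfrak f)=\sup_n\sup_pe^{\beta p}\big(\int_{\mathbb X}\int_\Omega e^{\alpha|f_n(\omega,x)-\mathbb E(f_n(\cdot,x)|\mathscr A_p)(\omega)|}\mathbb P(d\omega)\nu(dx)-1\big)$. $\tau^{\mathfrak f}_{x,t}=\min\{k\ge1:t+S^x_k+f_k(T^k(\omega,x))-f_0(\omega,x)<0\}$. *)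

(* Defs.v *)
From HB Require Import structures.
From mathcomp Require Import all_boot all_order all_algebra.
From mathcomp Require Import all_classical all_reals all_analysis.
Set Implicit Arguments. Unset Strict Implicit. Unset Printing Implicit Defensive.
Import Order.TTheory GRing.Theory Num.Theory.
Import numFieldNormedType.Exports.
Local Open Scope classical_set_scope.
Local Open Scope ring_scope.

Notation borelT T := (g_sigma_algebraType (@open T)).

Definition topological_group (G : topologicalType)
  (mul : G -> G -> G) (one : G) (inv : G -> G) : Prop :=
  [/\ associative mul, left_id one mul, left_inverse one inv mul,
      continuous (fun p : G * G => mul p.1 p.2) & continuous inv].

Definition continuous_action (G X : topologicalType)
  (mul : G -> G -> G) (one : G) (act : G -> X -> X) : Prop :=
  [/\ forall x, act one x = x,
      forall g h x, act (mul g h) x = act g (act h x) &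
      continuous (fun p : G * X => act p.1 p.2)].

Definition sc_lc_space (T : topologicalType) : Prop :=
  [/\ @second_countable T, locally_compact [set: T] & hausdorff_space T].

(* Omega = G^{N*}, coordinates omega = (g_1, g_2, ...) stored as w 0, w 1, ...
   with the product sigma-algebra generated by the coordinate cylinders. *)
Definition cylinders (G : ptopologicalType) : set (set (nat -> G)) :=
  fun C => exists (i : nat) (A : set (borelT G)),
    measurable A /\ C = [set w : nat -> G | A (w i)].

Definition Omega (G : ptopologicalType) := g_sigma_algebraType (@cylinders G).

Definition is_product_measure (R : realType) (G : ptopologicalType)
  (mu : probability (borelT G) R) (P : probability (Omega G) R) : Prop :=
  forall (p : nat) (A : nat -> set G),
    (forall i, measurable (A i : set (borelT G))) ->
    P [set w : Omega G | forall i, (i < p)%N -> A i (w i)] =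
    (\prod_(i < p) mu (A i))%E.

Definition stationary (R : realType) (G X : ptopologicalType)
  (act : G -> X -> X) (mu : probability (borelT G) R)
  (nu : probability (borelT X) R) : Prop :=
  forall A : set (borelT X), measurable A ->
    (\int[mu]_g nu (act g @^-1` A))%E = nu A.

Definition continuous_cocycle (R : realType) (G X : ptopologicalType)
  (mul : G -> G -> G) (act : G -> X -> X) (sigma : G -> X -> R) : Prop :=
  continuous (fun p : G * X => sigma p.1 p.2) /\
  forall g2 g1 x, sigma (mul g2 g1) x = sigma g2 (act g1 x) + sigma g1 x.

Definition exp_moment (R : realType) (G X : ptopologicalType)
  (mu : probability (borelT G) R) (sigma : G -> X -> R) : Prop :=
  exists a' : R, 0 < a' /\
    (\int[mu]_g expeR (a'%:E * ereal_sup (range (fun x => (`|sigma g x|)%:E))) < +oo)%E.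

Definition centered (R : realType) (G X : ptopologicalType)
  (mu : probability (borelT G) R) (sigma : G -> X -> R) : Prop :=
  forall x, (\int[mu]_g (sigma g x)%:E)%E = 0%E.

(* g_k ... g_1 for omega = w (g_i = w (i-1)) *)
Fixpoint gprod (G : Type) (mul : G -> G -> G) (one : G) (w : nat -> G) (k : nat) : G :=
  match k with 0 => one | k.+1 => mul (w k) (gprod mul one w k) end.

Definition Sx (R : realType) (G X : Type) (mul : G -> G -> G) (one : G)
  (sigma : G -> X -> R) (x : X) (k : nat) (w : nat -> G) : R :=
  sigma (gprod mul one w k) x.

Definition Titer (G X : Type) (mul : G -> G -> G) (one : G) (act : G -> X -> X)
  (k : nat) (w : nat -> G) (x : X) : (nat -> G) * X :=
  (fun i => w (i + k)%N, act (gprod mul one w k) x).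

(* E(h | A_p)(omega), A_p = sigma(g_1,...,g_p), computed for the product
   measure P: integrate out the coordinates g_{p+1}, g_{p+2}, ... *)
Definition splice (G : Type) (p : nat) (w w' : nat -> G) : nat -> G :=
  fun i => if (i < p)%N then w i else w' i.

Definition condexp_past (R : realType) (G : ptopologicalType)
  (P : probability (Omega G) R) (h : Omega G -> R) (p : nat) (w : Omega G) : R :=
  fine (\int[P]_w' (h (splice p w w'))%:E)%E.

(* the event {tau^f_{x,t} > n}, where
   tau = min{k >= 1 : t + S^x_k + f_k(T^k(omega,x)) - f_0(omega,x) < 0} *)
Definition tau_gt (R : realType) (G X : Type) (mul : G -> G -> G) (one : G)
  (act : G -> X -> X) (sigma : G -> X -> R) (f : nat -> (nat -> G) -> X -> R)
  (x : X) (t : R) (n : nat) : set (nat -> G) :=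
  [set w | forall k, (1 <= k <= n)%N ->
     0 <= t + Sx mul one sigma x k w
            + f k (Titer mul one act k w x).1 (Titer mul one act k w x).2
            - f 0%N w x].

Definition is_wiener (R : realType) (d : measure_display) (E : measurableType d)
  (PE : probability E R) (W : E -> R -> R) : Prop :=
  [/\ forall t, measurable_fun [set: E] (fun e => W e t),
      forall e, W e 0 = 0,
      forall e, {within [set t : R | 0 <= t], continuous (W e)} &
      forall (k : nat) (ts : nat -> R) (A : nat -> set R),
        ts 0%N = 0 -> (forall i, (i < k)%N -> ts i < ts i.+1) ->
        (forall i, measurable (A i)) ->
        PE [set e | forall i, (i < k)%N -> A i (W e (ts i.+1) - W e (ts i))] =
        (\prod_(i < k) normal_prob 0 (Num.sqrt (ts i.+1 - ts i)) (A i))%E].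

(* Main.v *)
Require Import Defs.
From HB Require Import structures.
From mathcomp Require Import all_boot all_order all_algebra.
From mathcomp Require Import all_classical all_reals all_analysis measurable_realfun.
From mathcomp Require Import ring lra.
Import Order.TTheory GRing.Theory Num.Theory.
Import numFieldNormedType.Exports.
Local Open Scope classical_set_scope.
Local Open Scope ring_scope.
Set Implicit Arguments.
Unset Strict Implicit.
Unset Printing Implicit Defensive.

(** Write Q for the law P x nu, Z_k = t + S_k, and consider the scales x = 2^j
    with the times N = x^6. Replacing f_k by its conditional expectation F_k
    on the first x coordinates makes "the perturbed walk survives up to time N,
    with a slack 1/x" an event A_j which depends on N + x coordinates only.
    Since Q is T-invariant, the approximation fails, or some |f_k o T^k| with
    k <= N exceeds x/4, with a probability kappa_j that decays faster than any
    power of x. Off these bad events A_(j+1) implies A_j (the slacks decrease)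
    and Z_k >= - 2x up to time N_(j+1). Put V_j = E[Z_N^+; A_j].

    - With L = 2x, Z + 2L killed when Z < - L is a supermartingale up to the tails of the
      increments beyond L, hence
      V_(j+1) <= V_j + O(x^2) Q(A_j) + rapidly decaying terms.
    - Either Z_N' is larger than h = eta x^3 / 2, which costs V_(j+1) / h, or it
      lies in a window of size O(eta sqrt N'), which has conditional probability
      at most 1/16 by the strong approximation at time 1 and the bound on the
      gaussian density, hence
      Q(A_(j+1)) <= V_(j+1) / h + Q(A_j) / 16 + rapidly decaying terms.

    As N_(j+1) = 64 N_j, the factor 1/16 beats the factor 8 = sqrt 64, and the
    two recursions together give V_j = O(1 + t^+) and
    Q(A_j) = O((1 + t^+) / sqrt N_j). *)

(** * Laws on the product space *)

(** The integral of a nonnegative function is a supremum over the simple functions below it, so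
    enlarging the function enlarges the family. This lets integrands be compared pointwise with no
    measurability proof on either side. *)
Lemma ge0_le_integralT_nonmeas d (T : measurableType d) (R : realType)
    (m : {measure set T -> \bar R}) (f g : T -> \bar R) :
  (forall x, 0 <= f x)%E -> (forall x, f x <= g x)%E ->
  (\int[m]_x f x <= \int[m]_x g x)%E.
Proof.
move=> f0 fg.
have g0 x : (0 <= g x)%E by exact: le_trans (fg x).
rewrite !ge0_integralTE//; apply: le_ereal_sup => _ [h hf <-].
by exists h => // x; exact: le_trans (fg x).
Qed.

Lemma ge0_integral_law d1 d2 (T1 : measurableType d1) (T2 : measurableType d2)
    (R : realType) (m1 : {measure set T1 -> \bar R})
    (m2 : {measure set T2 -> \bar R}) (phi : T1 -> T2) (f : T2 -> \bar R) :
  measurable_fun [set: T1] phi ->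
  (forall A, measurable A -> m1 (phi @^-1` A) = m2 A) ->
  measurable_fun [set: T2] f -> (forall y, 0 <= f y)%E ->
  (\int[m2]_y f y = \int[m1]_x f (phi x))%E.
Proof.
move=> mphi law mf f0.
transitivity (\int[pushforward m1 phi]_y f y)%E; last first.
  by rewrite ge0_integral_pushforward.
by apply/esym/eq_measure_integral => A mA _; exact: law.
Qed.

Section borel_product.
Variables (G X : ptopologicalType).
Hypotheses (scG : @second_countable G) (scX : @second_countable X).

(** Second countability makes an open set a countable union of rectangles taken from the two bases.
    Jointly continuous maps such as [act] and [sigma] thereby become measurable for the product
    sigma-algebra. *)
Lemma open_measurable_prod (O : set (G * X)) :
  open O -> measurable (O : set (borelT G * borelT X)).
Proof.
move=> oO; case: scG => B cB [Bo Bb]; case: scX => C cC [Co Cb].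
pose D := (B `*` C) `&` [set z | z.1 `*` z.2 `<=` O].
have cD : countable D.
  by apply: (sub_countable _ (countableX cB cC)); apply: subset_card_le => z [].
have -> : O = \bigcup_(z in D) (z.1 `*` z.2).
  apply/seteqP; split => [[g x] Ogx|z [[U V] [_ UVO] UVz]]; last exact: UVO.
  have [[U V] /= [nU nV] UVO] : nbhs (g, x) O by exact: open_nbhs_nbhs.
  have [U' [BU' U'g] U'U] := Bb g U nU.
  have [V' [CV' V'x] V'V] := Cb x V nV.
  exists (U', V') => //=; split => // -[a b] [/= U'a V'b].
  by apply: UVO; split; [exact: U'U|exact: V'V].
rewrite bigcup_set_type; apply: countable_bigcupT_measurable.
  by rewrite (eq_countable (card_setT _)).
move=> [[U V] /= /set_mem[/= [BU CV] _]]; apply: measurableX; apply: sub_sigma_algebra.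
  exact: Bo.
exact: Co.
Qed.

Lemma continuous_prod_measurable (Y : ptopologicalType) (h : G -> X -> Y) :
  continuous (fun p : G * X => h p.1 p.2) ->
  measurable_fun [set: borelT G * borelT X]
    (fun p => h p.1 p.2 : borelT Y).
Proof.
move=> ch; apply: (@measurability _ _ _ (borelT Y) _ _ (@open Y)) => // _ [A oA <-].
by rewrite setTI; apply: open_measurable_prod; move/continuousP: ch; exact.
Qed.

Lemma continuous_prod_measurable_real (R : realType) (h : G -> X -> R) :
  continuous (fun p : G * X => h p.1 p.2) ->
  measurable_fun [set: borelT G * borelT X] (fun p => h p.1 p.2).
Proof.
move=> ch; apply: (measurability _ (@RGenOpens.measurableE R)).
move=> _ [_ [a [b ->]] <-]; rewrite setTI; apply: open_measurable_prod.
by move/continuousP: ch; apply; exact: interval_open.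
Qed.

End borel_product.

Definition wshift (G : Type) (k : nat) (w : nat -> G) : nat -> G := fun i => w (i + k)%N.

Section product_space.
Variables (R : realType) (G : ptopologicalType) (mu : probability (borelT G) R).
Variables (P : probability (Omega G) R) (HP : is_product_measure mu P).

Lemma measurable_coord i : measurable_fun [set: Omega G] (fun w => w i : borelT G).
Proof.
by move=> _ A mA; rewrite setTI; apply: sub_sigma_algebra; exists i, A.
Qed.

Lemma measurable_funOmega d (T : measurableType d) (f : T -> Omega G) :
  (forall i, measurable_fun [set: T] (fun t => f t i : borelT G)) ->
  measurable_fun [set: T] f.
Proof.
move=> mf; apply: (@measurability _ _ _ (Omega G) _ _ (@cylinders G)) => // _ [_ [i [A [mA ->]]] <-].
exact: mf.
Qed.

Let rect := [set C : set (Omega G) | exists (p : nat) (A : nat -> set (borelT G)),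
  (forall i, measurable (A i)) /\ C = [set w | forall i, (i < p)%N -> A i (w i)]].

Let rect_measurable : rect `<=` measurable.
Proof.
move=> _ [p [A [mA ->]]].
rewrite (_ : mkset _ = \bigcap_(i in [set i | (i < p)%N]) [set w : Omega G | A i (w i)]).
  by apply: bigcap_measurableType => i _; apply: sub_sigma_algebra; exists i, (A i).
by apply/seteqP; split.
Qed.

(** Rectangles over finitely many coordinates form a pi-system that generates the sigma-algebra of
    [Omega G], and [HP] prescribes [P] on them. The invariance of [P] under shifting and splicing is
    then checked on rectangles only. *)
Lemma Omega_measure_unique (m : {measure set (Omega G) -> \bar R}) :
  (forall p (A : nat -> set (borelT G)), (forall i, measurable (A i)) ->
    m [set w | forall i, (i < p)%N -> A i (w i)] = (\prod_(i < p) mu (A i))%E) ->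
  forall A : set (Omega G), measurable A -> m A = P A.
Proof.
move=> mE A mA.
apply: (@g_sigma_algebra_measure_unique _ _ _ rect _ (fun=> setT)) => //.
- move=> _; exists 0%N, (fun=> setT); split=> //.
  by apply/seteqP; split.
- by rewrite bigcup_const//; exists 0%N.
(* Rectangles of different lengths are padded with full factors up to the longer length before being
   intersected. *)
- move=> _ _ [p [C [mC ->]]] [q [D [mD ->]]]; exists (maxn p q).
  exists (fun i => (if (i < p)%N then C i else setT) `&` (if (i < q)%N then D i else setT)).
  split.
    by move=> i; apply: measurableI; case: ifP.
  apply/seteqP; split => [w [Cw Dw] i _|w CDw].
    by split; case: ifP => //; [exact: Cw|exact: Dw].
  split=> i ip.
    by have := CDw i; rewrite leq_max ip/= => /(_ isT) [].
  by have := CDw i; rewrite leq_max ip/= orbT => /(_ isT) [].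
- by move=> _ [p [C [mC ->]]]; rewrite mE//; symmetry; exact: HP.
- move=> _; have := mE 0%N (fun=> setT); rewrite big_ord0.
  have -> : [set w : Omega G | forall i, (i < 0)%N -> [set: borelT G] (w i)] = setT.
    by apply/seteqP; split.
  by move=> -> //; rewrite ltry.
- move: A mA; apply: smallest_sub; first exact: smallest_sigma_algebra.
  move=> _ [i [A [mA ->]]]; apply: sub_sigma_algebra.
  exists i.+1, (fun j => if j == i then A else setT); split.
    by move=> j; case: ifP.
  apply/seteqP; split => [w Aw j _|w /(_ i)].
    by case: eqP => // ->.
  by rewrite ltnSn eqxx; exact.
Qed.

Lemma measurable_splice m :
  measurable_fun [set: Omega G * Omega G] (fun z => splice m z.1 z.2 : Omega G).
Proof.
apply: measurable_funOmega => i; rewrite /splice/=; case: (i < m)%N.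
  by apply: (measurableT_comp (measurable_coord i)); exact: measurable_fst.
by apply: (measurableT_comp (measurable_coord i)); exact: measurable_snd.
Qed.

Lemma measurable_shift k : measurable_fun [set: Omega G] (wshift k : Omega G -> Omega G).
Proof. by apply: measurable_funOmega => i; exact: measurable_coord. Qed.

Lemma shift_law k (A : set (Omega G)) : measurable A -> P ((wshift k : Omega G -> Omega G) @^-1` A) = P A.
Proof.
pose s : Omega G -> Omega G := wshift k.
have ms : measurable_fun setT s by exact: measurable_shift.
pose s' : {mfun Omega G >-> Omega G} := mfun_Sub (mem_set ms).
apply: (@Omega_measure_unique (pushforward P s')) => p {}A mA.
pose A' i := if (i < k)%N then setT else A (i - k)%N.
transitivity (P [set w : Omega G | forall i, (i < k + p)%N -> A' i (w i)]); last first.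
  rewrite HP; last by move=> i; rewrite /A'; case: ifP.
  rewrite big_split_ord/= big1 ?mul1e.
    apply: eq_bigr => i _; rewrite /A' ltnNge leq_addr/= addKn//.
  by move=> i _; rewrite /A' ltn_ord probability_setT.
congr (P _); apply/seteqP; split => w /= Aw i ip.
  rewrite /A'; case: ltnP => // ki.
  have := Aw (i - k)%N; rewrite /s'/= /s /wshift subnK//; apply.
  by rewrite ltn_subLR.
have := Aw (i + k)%N; rewrite /A' addnC ltn_add2l ip => /(_ isT).
by rewrite ltnNge leq_addr/= addKn /s' /= /s /wshift addnC.
Qed.

(** On a rectangle the constraints split into those on the first [m] coordinates and those on the
    others, which are independent. Resampling the future therefore preserves [P]; conditioning on
    the past will mean integrating over the second copy [w']. *)
Lemma splice_law m (A : set (Omega G)) : measurable A ->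
  (P \x P)%E ((fun z => splice m z.1 z.2 : Omega G) @^-1` A) = P A.
Proof.
pose s : Omega G * Omega G -> Omega G := fun z => splice m z.1 z.2.
have ms : measurable_fun setT s by exact: measurable_splice.
pose s' : {mfun (Omega G * Omega G)%type >-> Omega G} := mfun_Sub (mem_set ms).
apply: (@Omega_measure_unique (pushforward (P \x P)%E s')) => p {}A mA.
pose A1 i := if (i < m)%N then A i else setT.
pose A2 i := if (i < m)%N then setT else A i.
transitivity ((P \x P)%E ([set w : Omega G | forall i, (i < p)%N -> A1 i (w i)] `*`
                          [set w : Omega G | forall i, (i < p)%N -> A2 i (w i)])); last first.
  have mA1 i : measurable (A1 i) by rewrite /A1; case: ifP.
  have mA2 i : measurable (A2 i) by rewrite /A2; case: ifP.
  transitivity (P [set w : Omega G | forall i, (i < p)%N -> A1 i (w i)] *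
                P [set w : Omega G | forall i, (i < p)%N -> A2 i (w i)])%E.
    by apply: product_measure1E; apply: rect_measurable; [exists p, A1|exists p, A2].
  rewrite !HP// -big_split/=; apply: eq_bigr => i _.
  by rewrite /A1 /A2; case: ifP => _; rewrite probability_setT ?mule1 ?mul1e.
congr ((P \x P)%E _); apply/seteqP; split => [[w w'] /= Aw|[w w'] /= [Aw Aw'] i ip].
  split=> i ip; have := Aw i ip; rewrite /s'/= /s/splice/= /A1 /A2; by case: ifP.
have := Aw i ip; have := Aw' i ip; rewrite /s'/= /s/splice/= /A1 /A2; by case: ifP.
Qed.

Lemma coord_law m (A : set (borelT G)) : measurable A ->
  P [set w : Omega G | A (w m)] = mu A.
Proof.
move=> mA; pose A' i := if i == m then A else setT.
rewrite (_ : mkset _ = [set w : Omega G | forall i, (i < m.+1)%N -> A' i (w i)]).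
  rewrite HP; last by move=> i; rewrite /A'; case: ifP.
  rewrite big_ord_recr/= big1 ?mul1e /A' ?eqxx// => i _.
  by rewrite /= ltn_eqF ?ltn_ord// probability_setT.
apply/seteqP; split => [w /= Aw i _|w /(_ m)]; rewrite /A'.
  by case: eqP => // ->.
by rewrite eqxx; exact.
Qed.

End product_space.

(** * The walk, the skew product, and conditioning on the first steps *)

Section walk.
Variables (R : realType).
Variables (G : ptopologicalType) (mul : G -> G -> G) (one : G) (inv : G -> G).
Hypotheses (HG : topological_group mul one inv) (HGsp : sc_lc_space G).
Variables (mu : probability (borelT G) R).
Variables (P : probability (Omega G) R) (HP : is_product_measure mu P).
Variables (X : ptopologicalType) (act : G -> X -> X).
Hypotheses (Hact : continuous_action mul one act) (HXsp : sc_lc_space X).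
Variables (nu : probability (borelT X) R).
Variables (sigma : G -> X -> R) (Hsigma : continuous_cocycle mul act sigma).

Let scG : @second_countable G. Proof. by case: HGsp. Qed.
Let scX : @second_countable X. Proof. by case: HXsp. Qed.

Local Notation U := (Omega G * borelT X)%type.
Local Notation Q := (P \x nu)%E.

Definition pos (k : nat) (u : U) : borelT X := act (gprod mul one u.1 k) u.2.
(** Coordinates are numbered from 0: [incr k] is the increment between the times [k] and [k.+1], and
    the coordinate [u.1 k] is independent of [pos k u]. *)
Definition incr (k : nat) (u : U) : R := sigma (u.1 k) (pos k u).
Definition walk (k : nat) (u : U) : R := Sx mul one sigma u.2 k u.1.
Definition Tit (k : nat) (u : U) : U := Titer mul one act k u.1 u.2.

Lemma pos0 u : pos 0 u = u.2.
Proof. by case: Hact => a1 _ _; exact: a1. Qed.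

Lemma posS k u : pos k.+1 u = act (u.1 k) (pos k u).
Proof. by case: Hact => _ a2 _; exact: a2. Qed.

Lemma walk0 u : walk 0 u = 0.
Proof.
rewrite /walk /Sx /=; case: HG => _ m1 _ _ _; case: Hact => a1 _ _; case: Hsigma => _ /(_ one one u.2).
by rewrite m1 a1 => /eqP; rewrite -subr_eq subrr eq_sym => /eqP.
Qed.

Lemma walkS k u : walk k.+1 u = incr k u + walk k u.
Proof. by case: Hsigma => _ c; exact: c. Qed.

Lemma gprodD (w : nat -> G) m r :
  gprod mul one w (r + m)%N = mul (gprod mul one (wshift m w) r) (gprod mul one w m).
Proof.
case: HG => mA m1 _ _ _; elim: r => [|r IH]; first by rewrite /= m1.
by rewrite addSn /= IH mA.
Qed.

Lemma walkD m r u : walk (r + m)%N u = walk r (Tit m u) + walk m u.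
Proof. by rewrite /walk /Sx gprodD; case: Hsigma => _ c; exact: c. Qed.

Lemma TitS k u : Tit k.+1 u = Tit k (Tit 1 u).
Proof.
case: Hact => _ a2 _; rewrite /Tit /Titer -[in gprod _ _ _ k.+1]addn1 gprodD a2.
by congr pair; apply/funext => i; rewrite /= addn1 addnS.
Qed.

Lemma gprod_ext (w w' : nat -> G) k : (forall i, (i < k)%N -> w i = w' i) ->
  gprod mul one w k = gprod mul one w' k.
Proof.
elim: k => //= k IH e; rewrite e// IH// => i ik; apply: e; exact: ltnW.
Qed.

Lemma pos_ext k w w' x : (forall i, (i < k)%N -> w i = w' i) -> pos k (w, x) = pos k (w', x).
Proof. by move=> e; rewrite /pos /= (gprod_ext e). Qed.

Lemma walk_ext k w w' x : (forall i, (i < k)%N -> w i = w' i) -> walk k (w, x) = walk k (w', x).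
Proof. by move=> e; rewrite /walk /Sx /= (gprod_ext e). Qed.

Lemma measurable_act : measurable_fun [set: borelT G * borelT X]
  (fun p => act p.1 p.2 : borelT X).
Proof. by apply: continuous_prod_measurable => //; case: Hact. Qed.

Lemma measurable_sigma : measurable_fun [set: borelT G * borelT X] (fun p => sigma p.1 p.2).
Proof. by apply: continuous_prod_measurable_real => //; case: Hsigma. Qed.

Lemma measurable_ucoord k : measurable_fun [set: U] (fun u => u.1 k : borelT G).
Proof. by apply: (measurableT_comp (measurable_coord k)); exact: measurable_fst. Qed.

Lemma measurable_pos k : measurable_fun [set: U] (pos k).
Proof.
elim: k => [|k IH].
  apply: (eq_measurable_fun snd) => [u _|]; first by rewrite pos0.
  exact: measurable_snd.
apply: (eq_measurable_fun (fun u : U => act (u.1 k) (pos k u) : borelT X)) => [u _|].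
  by rewrite posS.
apply: (measurableT_comp measurable_act (g := fun u : U => (u.1 k : borelT G, pos k u))).
by apply: measurable_fun_pair => //; exact: measurable_ucoord.
Qed.

Lemma measurable_incr k : measurable_fun [set: U] (incr k).
Proof.
apply: (measurableT_comp measurable_sigma (g := fun u : U => (u.1 k : borelT G, pos k u))).
apply: measurable_fun_pair; [exact: measurable_ucoord|exact: measurable_pos].
Qed.

Lemma measurable_walk k : measurable_fun [set: U] (walk k).
Proof.
elim: k => [|k IH].
  apply: (eq_measurable_fun (fun _ : U => 0 : R)) => [u _|]; first by rewrite walk0.
  exact: measurable_cst.
apply: (eq_measurable_fun (fun u => incr k u + walk k u)) => [u _|]; first by rewrite walkS.
by apply: measurable_funD => //; exact: measurable_incr.
Qed.

Lemma measurable_Tit k : measurable_fun [set: U] (Tit k).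
Proof.
apply: measurable_fun_pair; last exact: measurable_pos.
apply: (@measurableT_comp _ _ _ _ _ _ (wshift k : Omega G -> Omega G)).
  exact: measurable_shift.
exact: measurable_fst.
Qed.

Lemma integral_iter (phi : U -> \bar R) : measurable_fun setT phi ->
  (forall u, 0 <= phi u)%E ->
  (\int[Q]_u phi u = \int[nu]_x \int[P]_w phi (w, x))%E.
Proof. by move=> mphi phi0; rewrite fubini_tonelli2. Qed.

Lemma integral_splice m (phi : U -> \bar R) : measurable_fun setT phi ->
  (forall u, 0 <= phi u)%E ->
  (\int[Q]_u phi u = \int[Q]_u \int[P]_w' phi (splice m u.1 w' : Omega G, u.2))%E.
Proof.
move=> mphi phi0.
have ms : measurable_fun [set: U * Omega G]
    (fun z => (splice m z.1.1 z.2 : Omega G, z.1.2) : U).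
  apply: measurable_fun_pair.
    apply: (measurableT_comp (measurable_splice m)
      (g := fun z : U * Omega G => (z.1.1, z.2))).
    apply: measurable_fun_pair; last exact: measurable_snd.
    by apply: measurableT_comp; [exact: measurable_fst|exact: measurable_fst].
  by apply: measurableT_comp; [exact: measurable_snd|exact: measurable_fst].
have mpsi : measurable_fun [set: U * Omega G]
    (fun z => phi (splice m z.1.1 z.2 : Omega G, z.1.2)).
  exact: (measurableT_comp mphi ms).
rewrite integral_iter// integral_iter//; first last.
- by move=> u; exact: integral_ge0.
- exact: (measurable_fun_fubini_tonelli_F _ mpsi).
apply: eq_integral => x _.
have mphix : measurable_fun [set: Omega G] (fun w => phi (w, x)).
  exact: measurableT_comp (pair2_measurable x).
rewrite (ge0_integral_law (measurable_splice m) (splice_law HP m) mphix)//.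
rewrite fubini_tonelli1//.
exact: (measurableT_comp mphix (measurable_splice m)).
Qed.

(* psi need not depend on the first m coordinates only: splicing preserves the law. *)
Lemma le_integral_cond m (phi psi : U -> \bar R) :
  measurable_fun setT phi -> (forall u, 0 <= phi u)%E ->
  (forall w x, \int[P]_w' phi (splice m w w' : Omega G, x) <= psi (w, x))%E ->
  (\int[Q]_u phi u <= \int[Q]_u psi u)%E.
Proof.
move=> mphi phi0 le; rewrite (integral_splice m)//.
apply: ge0_le_integralT_nonmeas => [u|[w x]]; last exact: le.
exact: integral_ge0.
Qed.

End walk.

(** * The killed walk *)

Lemma probability_integral_cst d (T : measurableType d) (R : realType)
    (m : probability T R) (c : \bar R) : (\int[m]_x c = c)%E.
Proof.
by rewrite integral_cst// -[RHS]mule1; congr (_ * _)%E; exact: probability_setT.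
Qed.

Lemma integral_indicT d (T : measurableType d) (R : realType)
    (m : {measure set T -> \bar R}) (A : set T) :
  measurable A -> (\int[m]_x (\1_A x)%:E = m A)%E.
Proof. by move=> mA; rewrite integral_indic// setIT. Qed.

Lemma product_measure_ysection d1 d2 (T1 : measurableType d1) (T2 : measurableType d2)
    (R : realType) (m1 : {sigma_finite_measure set T1 -> \bar R})
    (m2 : {sigma_finite_measure set T2 -> \bar R}) (S : set (T1 * T2)) :
  measurable S -> ((m1 \x m2) S = \int[m2]_y m1 [set x | S (x, y)])%E.
Proof.
move=> mS; rewrite -integral_indicT//.
rewrite fubini_tonelli2//; last first.
  by apply/measurable_EFinP; exact: measurable_indic.
apply: eq_integral => y _; rewrite /fubini_G.
have mSy : measurable [set x | S (x, y)].
  have := measurable_ysection y mS; congr (measurable _).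
  by apply/seteqP; split => x /=; rewrite /ysection/= inE.
rewrite -integral_indicT//.
Qed.

Lemma measurable_le_fun d (T : measurableType d) (R : realType) (f : T -> R) (a : R) :
  measurable_fun setT f -> measurable [set u | a <= f u].
Proof.
move=> mf; have -> : [set u | a <= f u] = f @^-1` `[a, +oo[%classic.
  by apply/seteqP; split => u /=; rewrite in_itv/= andbT.
by rewrite -[X in measurable X]setTI; exact: mf.
Qed.

Lemma measurable_between d (T : measurableType d) (R : realType) (f : T -> R) (a b : R) :
  measurable_fun setT f -> measurable [set u | a <= f u <= b].
Proof.
move=> mf; have -> : [set u | a <= f u <= b] = f @^-1` `[a, b]%classic.
  by apply/seteqP; split => u /=; rewrite in_itv.
by rewrite -[X in measurable X]setTI; exact: mf.
Qed.

Lemma measurable_lt_norm d (T : measurableType d) (R : realType) (f : T -> R) (a : R) :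
  measurable_fun setT f -> measurable [set u | a < `|f u|].
Proof.
move=> mf; have -> : [set u | a < `|f u|] = (fun u => `|f u|) @^-1` `]a, +oo[%classic.
  by apply/seteqP; split => u /=; rewrite in_itv/= andbT.
by rewrite -[X in measurable X]setTI; apply: measurableT_comp.
Qed.

Definition tail (R : realType) (L s : R) : R := if L < `|s| then `|s| else 0.

Lemma tail_ge0 (R : realType) (L s : R) : 0 <= tail L s.
Proof. by rewrite /tail; case: ifP. Qed.

Lemma tail_le (R : realType) (L s : R) : tail L s <= `|s|.
Proof. by rewrite /tail; case: ifP. Qed.

Lemma norm_le_tail (R : realType) (L s : R) : 0 <= L -> `|s| <= L + tail L s.
Proof. by move=> L0; rewrite /tail; case: ltP => ?; rewrite ?addr0// lerDr. Qed.

Lemma measurable_tail (R : realType) (L : R) : measurable_fun setT (tail L).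
Proof.
apply: measurable_fun_ifT => //.
by apply: measurable_fun_ltr => //; exact: normr_measurable.
Qed.

Section killed_walk.
Variables (R : realType).
Variables (G : ptopologicalType) (mul : G -> G -> G) (one : G) (inv : G -> G).
Hypotheses (HG : topological_group mul one inv) (HGsp : sc_lc_space G).
Variables (mu : probability (borelT G) R).
Variables (P : probability (Omega G) R) (HP : is_product_measure mu P).
Variables (X : ptopologicalType) (act : G -> X -> X).
Hypotheses (Hact : continuous_action mul one act) (HXsp : sc_lc_space X).
Variables (nu : probability (borelT X) R).
Variables (sigma : G -> X -> R) (Hsigma : continuous_cocycle mul act sigma).

Local Notation U := (Omega G * borelT X)%type.
Local Notation Q := (P \x nu)%E.
Local Notation pos := (@pos G mul one X act).
Local Notation incr := (@incr R G mul one X act sigma).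
Local Notation walk := (@walk R G mul one X sigma).
Local Notation Tit := (@Tit G mul one X act).

(** Tested on a rectangle [C] times [D]: for a fixed starting point, the first coordinate decides
    whether the new position lies in [D], and the shifted sequence, independent of it, decides about
    [C]. Integrating the first factor over the starting point yields [nu D] by stationarity. *)
Lemma Tit1_law (Hnu : stationary act mu nu) (A : set U) : measurable A ->
  Q (Tit 1 @^-1` A) = Q A.
Proof.
have mT : measurable_fun [set: U] (Tit 1).
  exact: (measurable_Tit HGsp Hact HXsp).
pose T' : {mfun U >-> U} := mfun_Sub (mem_set mT).
move=> mA; symmetry.
apply: (@product_measure_unique _ _ _ _ _ P nu (pushforward Q T')) => // C D mC mD.
have mact := measurable_act HGsp Hact HXsp.
rewrite [LHS]product_measure_ysection; last first.
  by rewrite -[X in measurable X]setTI; apply: (mT) => //; exact: measurableX.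
pose I x := mu [set g | D (act g x)].
have mI x : measurable ([set g | D (act g x)] : set (borelT G)).
  have := measurableT_comp mact (pair2_measurable (x : borelT X)).
  by move=> /(_ measurableT D mD); rewrite setTI.
transitivity (\int[nu]_x (P C * I x))%E.
  apply: eq_integral => x _.
  pose S := [set w : Omega G | (Tit 1 @^-1` (C `*` D)) (w, x)].
  have mS : measurable S.
    have := mT measurableT _ (measurableX mC mD); rewrite setTI => mTCD.
    by have := pair2_measurable (x : borelT X) measurableT mTCD; rewrite setTI.
  transitivity (P S); first by [].
  (* Splicing at 1 takes the first coordinate and the later ones from two different copies, which
     turns the event into a product set. *)
  rewrite -(splice_law HP 1 mS).
  transitivity ((P \x P)%E ([set w : Omega G | D (act (w 0%N) x)] `*`
      ((wshift 1 : Omega G -> Omega G) @^-1` C))).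
    apply: (congr1 (fun S => (P \x P)%E S)); apply/seteqP; split => [[w w']|[w w']] /=.
      rewrite /S /= /Tit /Titer /= => -[Cw Dw]; split.
        move: Dw; rewrite /splice /=; case: Hact => a1 a2 _; rewrite a2 a1//.
      congr (C _) : Cw; apply/funext => i.
      by rewrite /splice /wshift addn1.
    rewrite /S /= /Tit /Titer /= => -[Dw Cw]; split.
      congr (C _) : Cw; apply/funext => i.
      by rewrite /splice /wshift addn1.
    by move: Dw; rewrite /splice /=; case: Hact => a1 a2 _; rewrite a2 a1.
  transitivity (P [set w : Omega G | D (act (w 0%N) x)] *
      P ((wshift 1 : Omega G -> Omega G) @^-1` C))%E.
    apply: product_measure1E.
      by have := measurable_coord 0%N measurableT (mI x); rewrite setTI.
    by have := measurable_shift 1 measurableT mC; rewrite setTI.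
  by rewrite (shift_law HP)// (coord_law HP 0 (mI x)) muleC.
have mS : measurable [set p : borelT G * borelT X | D (act p.1 p.2)].
  by have := mact measurableT D mD; rewrite setTI.
have mII : measurable_fun [set: borelT X] I.
  have := measurable_fun_ysection mu mS.
  apply: eq_measurable_fun => x _ /=; congr (mu _).
  by apply/seteqP; split => g /=; rewrite /ysection/= inE.
rewrite ge0_integralZl//; congr (_ * _)%E.
apply: etrans (Hnu D mD).
apply: etrans (esym (product_measure_ysection mu nu mS)) _.
apply: eq_integral => g _ /=; congr (nu _).
by apply/seteqP; split => x /=; rewrite /xsection/= inE.
Qed.

Lemma Tit_law (Hnu : stationary act mu nu) k (A : set U) : measurable A ->
  Q (Tit k @^-1` A) = Q A.
Proof.
elim: k A => [|k IH] A mA.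
  have T0 : Tit 0 = id.
    apply/funext => -[w x]; rewrite /Tit /Titer /=; case: Hact => -> _ _.
    by congr pair; apply/funext => i; rewrite addn0.
  by rewrite T0 preimage_id.
rewrite -[RHS]IH// -[RHS](Tit1_law Hnu).
  apply: (congr1 (fun S => Q S)); apply/seteqP; split => u /=; rewrite (TitS HG Hact k u); exact.
rewrite -[X in measurable X]setTI.
exact: (measurable_Tit HGsp Hact HXsp).
Qed.

(** Being determined by the first [m] coordinates and the starting point is stated as invariance
    under changes of the later coordinates: this is the form in which [splice] uses it. *)
Definition adapted (m : nat) (H : set U) :=
  forall (w w' : nat -> G) x, (forall i, (i < m)%N -> w i = w' i) -> H (w, x) -> H (w', x).

Variables (L tau : R) (L0 : 0 <= L) (tau0 : 0 <= tau).
Hypothesis Hint : forall y, mu.-integrable setT (fun g => (sigma g y)%:E).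
Hypothesis Hcent : centered mu sigma.
Hypothesis Htau : forall y, (\int[mu]_g (tail L (sigma g y))%:E <= tau%:E)%E.

Let msig y : measurable_fun [set: borelT G] (fun g => sigma g y).
Proof.
exact: (measurableT_comp (measurable_sigma HGsp HXsp Hsigma) (pair2_measurable (y : borelT X))).
Qed.

Let mtail y : measurable_fun [set: borelT G] (fun g => tail L (sigma g y)).
Proof. by apply: measurableT_comp => //; exact: measurable_tail. Qed.

(** Centering removes the mean of the increment. The added tail keeps the integrand nonnegative,
    since an increment is at least [- L] minus its tail and [z + 2 * L] is at least [L]. *)
Lemma one_step_bound z y : - L <= z ->
  (\int[mu]_g (z + 2 * L + sigma g y + tail L (sigma g y))%:E <= (z + 2 * L + tau)%:E)%E.
Proof.
move=> Lz.
under eq_integral do rewrite EFinD EFinD.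
have it : mu.-integrable setT (fun g => (tail L (sigma g y))%:E).
  apply: (le_integrable _ _ _ (Hint y)) => //; first exact/measurable_EFinP.
  move=> g _ /=; rewrite lee_fin ger0_norm ?tail_ge0//.
  exact: tail_le.
have ic : mu.-integrable setT (fun g : borelT G => (z + 2 * L)%:E).
  exact: finite_measure_integrable_cst.
rewrite integralD//; last exact: integrableD.
rewrite integralD// probability_integral_cst Hcent adde0 [leRHS]EFinD.
by apply: leeD => //; exact: Htau.
Qed.

Lemma coord_integral k (F : borelT G -> \bar R) : measurable_fun setT F ->
  (forall g, 0 <= F g)%E -> (\int[P]_w F (w k) = \int[mu]_g F g)%E.
Proof.
move=> mF F0; symmetry; apply: (ge0_integral_law (measurable_coord k)) => // A mA.
exact: coord_law.
Qed.

Lemma tail_incr_le k : (\int[Q]_u (tail L (incr k u))%:E <= tau%:E)%E.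
Proof.
rewrite -(probability_integral_cst Q tau%:E).
apply: (le_integral_cond HP nu (m := k)).
- apply/measurable_EFinP; apply: (measurableT_comp (measurable_tail L)).
  exact: (measurable_incr HGsp Hact HXsp Hsigma).
- by move=> u; rewrite lee_fin tail_ge0.
move=> w x.
have -> : (\int[P]_w' (tail L (incr k (splice k w w' : Omega G, x)))%:E =
    \int[P]_w' (tail L (sigma (w' k) (pos k (w, x))))%:E)%E.
  apply: eq_integral => w' _; rewrite /incr /Defs.splice /= ltnn.
  by rewrite (pos_ext mul one act (w' := w))// => i ik; rewrite ik.
rewrite (coord_integral k (F := fun g => (tail L (sigma g (pos k (w, x))))%:E))//.
  by apply/measurable_EFinP; exact: mtail.
by move=> g; rewrite lee_fin tail_ge0.
Qed.

(** Each increment is at most [L] plus its tail. The constant [L] is integrated over [H] only, which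
    yields the factor [Q H], while the tails are so small that they may be integrated over the whole
    space. *)
Lemma walk_oscillation (H : set U) m r : measurable H ->
  (\int[Q]_u (\1_H u * `|walk (m + r)%N u - walk m u|)%:E
     <= (r%:R * L)%:E * Q H + (r%:R * tau)%:E)%E.
Proof.
move=> mH.
have mw := measurable_walk HG HGsp Hact HXsp Hsigma.
have m1 : measurable_fun setT (\1_H : U -> R) by exact: measurable_indic.
elim: r => [|r IH].
  rewrite addn0 integral0_eq; first by rewrite !mul0r mul0e add0e.
  by move=> u _; rewrite subrr normr0 mulr0.
have mf : measurable_fun setT (fun u => \1_H u * `|walk (m + r)%N u - walk m u|).
  apply: measurable_funM => //; apply: measurableT_comp => //.
  exact: measurable_funB.
have mg : measurable_fun setT (fun u : U => L * \1_H u).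
  by apply: measurable_funM => //; exact: measurable_cst.
have mt : measurable_fun setT (fun u => tail L (incr (m + r)%N u)).
  apply: (measurableT_comp (measurable_tail L)).
  exact: (measurable_incr HGsp Hact HXsp Hsigma).
have f0 u : 0 <= \1_H u * `|walk (m + r)%N u - walk m u|.
  by apply: mulr_ge0.
have g0 u : 0 <= L * \1_H u by apply: mulr_ge0.
have t0 u : 0 <= tail L (incr (m + r)%N u) by exact: tail_ge0.
apply: (@le_trans _ _ (\int[Q]_u ((\1_H u * `|walk (m + r)%N u - walk m u|)%:E +
    (L * \1_H u)%:E + (tail L (incr (m + r)%N u))%:E))%E).
  apply: ge0_le_integralT_nonmeas => u.
    by rewrite lee_fin mulr_ge0.
  rewrite -!EFinD lee_fin addnS (walkS one Hsigma) indicE; case: (u \in H) => /=.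
    rewrite !mul1r mulr1 -[incr _ _ + _ - _]addrA.
    have := ler_normD (walk (m + r)%N u - walk m u) (incr (m + r)%N u).
    rewrite [_ + incr _ _]addrC; have := norm_le_tail (incr (m + r)%N u) L0; lra.
  by rewrite !mul0r mulr0 !add0r.
do 2 (rewrite ge0_integralD//; try by
  [apply/measurable_EFinP|apply/measurable_EFinP; exact: measurable_funD
  |move=> u _; rewrite -?EFinD lee_fin ?addr_ge0]).
apply: (@le_trans _ _ ((r%:R * L)%:E * Q H + (r%:R * tau)%:E + L%:E * Q H + tau%:E)%E).
  apply: leeD; last exact: tail_incr_le.
  apply: leeD => //.
  under eq_integral do rewrite EFinM.
  rewrite ge0_integralZl//; try by [apply/measurable_EFinP|rewrite integral_indicT].
have QH : Q H \is a fin_num by exact: (@fin_num_measure _ _ _ (Q : probability U R)).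
rewrite -(fineK QH) -!EFinM -!EFinD lee_fin -natr1; lra.
Qed.

Variable t : R.
Local Notation Z := (fun k u => t + walk k u).

(** The barrier is tested at every time from [m] to [m + r], both included; in particular
    [alive H m 0] is smaller than [H] in general. *)
Fixpoint alive (H : set U) (m r : nat) : set U :=
  (if r is r'.+1 then alive H m r' else H) `&` [set u | - L <= Z (m + r)%N u].

Lemma alive_intro H m r u : H u ->
  (forall i, (m <= i <= m + r)%N -> - L <= Z i u) -> alive H m r u.
Proof.
elim: r => [|r IH] Hu h; split => //=; try by apply: h; rewrite leq_addr leqnn.
apply: IH => // i /andP[mi ir]; apply: h; rewrite mi/=.
by rewrite addnS ltnW.
Qed.

Lemma alive_last H m r u : alive H m r u -> - L <= Z (m + r)%N u.
Proof. by case: r => [|r] []. Qed.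

Lemma measurable_alive H m r : measurable H -> measurable (alive H m r).
Proof.
move=> mH; have mZ k : measurable [set u | - L <= Z k u].
  apply: measurable_le_fun; apply: measurable_funD => //.
  exact: (measurable_walk HG HGsp Hact HXsp Hsigma).
by elim: r => [|r IH]; exact: measurableI.
Qed.

Lemma adapted_alive H m r : adapted m H -> adapted (m + r)%N (alive H m r).
Proof.
move=> aH; elim: r => [|r IH] w w' x e /= [Aw Lw]; split.
- by apply: (aH w) => // i im; apply: e; rewrite addn0.
- by rewrite -(walk_ext mul one sigma x e).
- by apply: (IH w) => // i im; apply: e; rewrite addnS ltnW.
- by rewrite -(walk_ext mul one sigma x e).
Qed.

(* The payoff Z + 2L absorbs the overshoot: a step of size at most L below - L
   leaves it nonnegative, so that killing can only decrease it. *)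
Lemma killed_walk_step H m r : measurable H -> adapted m H ->
  (\int[Q]_u (\1_(alive H m r.+1) u * (Z (m + r.+1)%N u + 2 * L))%:E
   <= \int[Q]_u (\1_(alive H m r) u * (Z (m + r)%N u + 2 * L))%:E + tau%:E)%E.
Proof.
move=> mH aH.
have mw := measurable_walk HG HGsp Hact HXsp Hsigma.
have mA s := measurable_alive m s mH.
have m1 s : measurable_fun setT (\1_(alive H m s) : U -> R) by exact: measurable_indic.
have mZ k : measurable_fun setT (fun u => Z k u + 2 * L).
  by apply: measurable_funD => //; apply: measurable_funD.
have pZ s u : 0 <= \1_(alive H m s) u * (Z (m + s)%N u + 2 * L).
  rewrite indicE; case: (boolP (u \in _)); last by rewrite mul0r.
  rewrite inE mul1r => As.
  by have := alive_last As; have := L0; lra.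
have mY s : measurable_fun setT (fun u => \1_(alive H m s) u * (Z (m + s)%N u + 2 * L)).
  exact: measurable_funM.
apply: (@le_trans _ _ (\int[Q]_u ((\1_(alive H m r) u * (Z (m + r)%N u + 2 * L))%:E +
    (tau * \1_(alive H m r) u)%:E))%E); last first.
  rewrite ge0_integralD//; try by
    [apply/measurable_EFinP|apply/measurable_EFinP; exact: measurable_funM
    |move=> u _; rewrite lee_fin; exact: pZ|move=> u _; rewrite lee_fin mulr_ge0].
  apply: leeD => //.
  rewrite -[leRHS](probability_integral_cst Q).
  apply: ge0_le_integralT_nonmeas => u; rewrite lee_fin; first by rewrite mulr_ge0.
  by rewrite ler_piMr// indicE; case: (u \in _).
(* Conditionally on the first [m + r] coordinates, the survival so far, the position [y] and the
   height [z] are frozen, and the next increment uses a fresh group element. *)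
apply: (le_integral_cond HP nu (m := (m + r)%N)).
- exact/measurable_EFinP.
- by move=> u; rewrite lee_fin.
move=> w x; set y := pos (m + r)%N (w, x); set z := Z (m + r)%N (w, x).
have spl w' i : (i < m + r)%N -> w i = splice (m + r) w w' i.
  by move=> im; rewrite /Defs.splice im.
have Aw w' : alive H m r (splice (m + r) w w', x) -> alive H m r (w, x).
  by apply: adapted_alive => // i /(spl w') ->.
have Zw w' : Z (m + r.+1)%N (splice (m + r) w w', x) = z + sigma (w' (m + r)%N) y.
  rewrite addnS (walkS one Hsigma) /z /y /incr /= /Defs.splice ltnn.
  rewrite -(pos_ext mul one act x (spl w')) -(walk_ext mul one sigma x (spl w')).
  by rewrite -addrA [sigma _ _ + _]addrC addrA.
have [Ar|nAr] := pselect (alive H m r (w, x)); last first.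
  rewrite integral0_eq; first by rewrite -EFinD lee_fin indicE memNset// mulr0 mul0r addr0.
  move=> w' _; rewrite indicE memNset ?mul0r// => -[+ _]; exact: contra_not (Aw w') nAr.
have Lz : - L <= z := alive_last Ar.
rewrite -EFinD indicE mem_set// mul1r mulr1.
apply: le_trans (one_step_bound y Lz).
rewrite -(coord_integral (m + r)%N); last 2 first.
- apply/measurable_EFinP; apply: measurable_funD => //; apply: measurable_funD => //.
- move=> g; rewrite lee_fin; have := norm_le_tail (sigma g y) L0.
  have := ler_norm (- sigma g y); rewrite normrN; have := L0; lra.
apply: ge0_le_integralT_nonmeas => w'; first by rewrite lee_fin.
rewrite lee_fin indicE; case: (boolP (_ \in _)) => _.
  rewrite mul1r Zw; have := tail_ge0 L (sigma (w' (m + r)%N) y); lra.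
(* If the walk has been killed the left side is 0, and the payoff completed by the tail is still
   nonnegative. *)
rewrite mul0r; have := norm_le_tail (sigma (w' (m + r)%N) y) L0.
have := ler_norm (- sigma (w' (m + r)%N) y); rewrite normrN; have := L0; lra.
Qed.

Lemma killed_walk_bound H m r : measurable H -> adapted m H ->
  (\int[Q]_u (\1_(alive H m r) u * (Z (m + r)%N u + 2 * L))%:E
   <= \int[Q]_u (\1_(alive H m 0) u * (Z m u + 2 * L))%:E + (r%:R * tau)%:E)%E.
Proof.
move=> mH aH; elim: r => [|r IH]; first by rewrite addn0 mul0r adde0.
apply: le_trans (killed_walk_step r mH aH) _.
have -> : (r.+1%:R * tau)%:E = ((r%:R * tau)%:E + tau%:E)%E.
  by rewrite -EFinD -natr1 mulrDl mul1r.
by rewrite addeA; apply: leeD.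
Qed.

End killed_walk.

(** * Exponential moments and anticoncentration *)

Section exponential_moment.
Variables (R : realType) (G X : ptopologicalType).
Variables (mu : probability (borelT G) R) (sigma : G -> X -> R).
Hypothesis msigma : forall y, measurable_fun [set: borelT G] (fun g => sigma g y).

(** For every [y] the value at [y] is dominated by the supremum, so the assumed moment itself serves
    as a bound uniform in [y]. *)
Lemma exp_moment_unif : exp_moment mu sigma ->
  exists a M : R, [/\ 0 < a, 0 <= M &
    forall y, (\int[mu]_g (expR (a * `|sigma g y|))%:E <= M%:E)%E].
Proof.
case=> a [a0]; set I := (\int[mu]_g _)%E => Ioo.
have I0 : (0 <= I)%E by apply: integral_ge0 => g _; exact: expeR_ge0.
have Ifin : I \is a fin_num by rewrite ge0_fin_numE.
exists a, (fine I); split => // [|y]; first exact: fine_ge0.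
rewrite fineK//; apply: ge0_le_integralT_nonmeas => g; first by rewrite lee_fin expR_ge0.
rewrite -[leLHS]/(expeR (a * `|sigma g y|)%:E) lee_expeR EFinM.
apply: lee_pmul => //; first by rewrite lee_fin ltW.
by apply: ereal_sup_ubound; exists y.
Qed.

Variables (a M : R) (a0 : 0 < a) (M0 : 0 <= M).
Hypothesis HM : forall y, (\int[mu]_g (expR (a * `|sigma g y|))%:E <= M%:E)%E.

Let mexp y : measurable_fun [set: borelT G] (fun g => expR (a * `|sigma g y|)).
Proof.
apply: (measurableT_comp (@measurable_expR R)); apply: measurable_funM => //.
exact: measurableT_comp.
Qed.

Lemma exp_moment_integrable y : mu.-integrable setT (fun g => (sigma g y)%:E).
Proof.
apply/integrableP; split; first exact/measurable_EFinP.
apply: (@le_lt_trans _ _ (\int[mu]_g ((a^-1)%:E * (expR (a * `|sigma g y|))%:E))%E).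
  apply: ge0_le_integralT_nonmeas => g; first exact: abse_ge0.
  rewrite -EFinM lee_fin -ler_pdivrMl ?invr_gt0// invrK.
  by have := expR_ge1Dx (a * `|sigma g y|); lra.
have a1 : (0 <= (a^-1)%:E)%E by rewrite lee_fin invr_ge0 ltW.
rewrite ge0_integralZl//; try by
  [apply/measurable_EFinP|move=> g _; rewrite lee_fin expR_ge0].
rewrite (le_lt_trans _ (ltry (a^-1 * M)))// EFinM; apply: lee_pmul => //.
by apply: integral_ge0 => g _; rewrite lee_fin expR_ge0.
Qed.

(** For [s] above [L], half of the exponential rate absorbs the factor [s], through s <= (2/a) exp(a
    s/2), and the other half produces the decay, through exp(a s/2) <= exp(-a L/2) exp(a s). *)
Lemma exp_moment_tail (L : R) y :
  (\int[mu]_g (tail L (sigma g y))%:E <= (2 / a * M * expR (- (a / 2) * L))%:E)%E.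
Proof.
pose C := 2 / a * expR (- (a / 2) * L).
have C0 : 0 <= C by rewrite mulr_ge0 ?expR_ge0// divr_ge0// ltW.
apply: (@le_trans _ _ (\int[mu]_g (C%:E * (expR (a * `|sigma g y|))%:E))%E).
  apply: ge0_le_integralT_nonmeas => g; first by rewrite lee_fin tail_ge0.
  rewrite -EFinM lee_fin /tail; case: ltP => [Ls|_]; last by rewrite mulr_ge0 ?expR_ge0.
  set s := `|_| in Ls *.
  have s1 : s <= 2 / a * expR (a / 2 * s).
    rewrite -ler_pdivrMl ?divr_gt0// invf_div.
    by have := expR_ge1Dx (a / 2 * s); lra.
  apply: (le_trans s1); rewrite /C -[leRHS]mulrA; apply: ler_wpM2l; first by rewrite divr_ge0 ?(ltW a0).
  rewrite -expRD ler_expR.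
  have : a / 2 * L <= a / 2 * s by apply: ler_wpM2l; [rewrite divr_ge0 ?(ltW a0)|exact: ltW].
  rewrite /s; lra.
rewrite ge0_integralZl//; try by
  [apply/measurable_EFinP|move=> g _; rewrite lee_fin expR_ge0].
rewrite [leRHS](_ : _ = (C%:E * M%:E)%E); last by rewrite -EFinM /C mulrAC.
apply: lee_pmul => //.
by apply: integral_ge0 => g _; rewrite lee_fin expR_ge0.
Qed.

End exponential_moment.

(** The gaussian density never exceeds its peak, which is at most [s^-1] because 2 pi is at least
    1. *)
Lemma normal_prob_itv_le (R : realType) (s b l : R) : 0 < s -> 0 <= l ->
  (normal_prob 0 s `[b, (b + l)%R]%classic <= (l / s)%:E)%E.
Proof.
move=> s0 l0; rewrite /normal_prob.
apply: (@le_trans _ _ (\int[lebesgue_measure]_(x in `[b, (b + l)%R]%classic) (s^-1)%:E)%E).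
  apply: ge0_le_integral => //.
  - by move=> x _; rewrite lee_fin normal_pdf_ge0.
  - apply/measurable_EFinP; apply: measurable_funTS; exact: measurable_normal_pdf.
  move=> x _; rewrite lee_fin; apply: le_trans (normal_pdf_ub _ _ _) _.
    by rewrite gt_eqF.
  rewrite /normal_peak lef_pV2 ?posrE//; last first.
    by rewrite sqrtr_gt0 mulrn_wgt0// mulr_gt0 ?pi_gt0 ?exprn_gt0.
  rewrite -[leLHS](gtr0_norm s0) -sqrtr_sqr ler_wsqrtr// -mulrnAr ler_peMr ?sqr_ge0//.
  by have := pi_ge2 R; rewrite mulr2n; lra.
rewrite integral_cst// [X in (_ * X)%E]lebesgue_measure_itv/= lte_fin.
case: ifP => _; last by rewrite mule0 lee_fin divr_ge0// ltW.
by rewrite -EFinB -EFinM lee_fin addrAC subrr add0r mulrC.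
Qed.

Section anticoncentration.
Variables (R : realType).
Variables (G : ptopologicalType) (mul : G -> G -> G) (one : G) (inv : G -> G).
Hypotheses (HG : topological_group mul one inv) (HGsp : sc_lc_space G).
Variables (P : probability (Omega G) R).
Variables (X : ptopologicalType) (act : G -> X -> X).
Hypotheses (Hact : continuous_action mul one act) (HXsp : sc_lc_space X).
Variables (sigma : G -> X -> R) (Hsigma : continuous_cocycle mul act sigma).
Variables (dE : measure_display) (E : measurableType dE) (PE : probability E R).
Variables (pi : E -> Omega G) (Hpi : measurable_fun [set: E] pi).
Hypothesis Hpi_law : forall A : set (Omega G), measurable A -> PE (pi @^-1` A) = P A.
Variables (W : E -> R -> R) (HW : is_wiener PE W) (v : R) (Hv : 0 < v).

Let S k (x : X) (w : Omega G) : R := Sx mul one sigma x k w.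

Lemma measurable_Sx k x : measurable_fun [set: Omega G] (S k x).
Proof.
exact: (measurableT_comp (measurable_walk HG HGsp Hact HXsp Hsigma k)
  (pair2_measurable (x : borelT X))).
Qed.

Definition sup_deviation (c : R) (x : X) (n : nat) : set E :=
  [set e | exists s : R, 0 <= s <= 1 /\
    c < `| Sx mul one sigma x (Num.truncn (n%:R * s)) (pi e) - v * W e (n%:R * s) |].

(* Right continuity in time reduces the supremum to rational times. *)
Lemma measurable_sup_deviation c x n : (0 < n)%N -> measurable (sup_deviation c x n).
Proof.
move=> n0; have n0R : 0 < n%:R :> R by rewrite ltr0n.
pose F s e := S (Num.truncn (n%:R * s)) x (pi e) - v * W e (n%:R * s).
case: HW => mW W0 cW _.
have mF s : measurable_fun setT (F s).
  apply: measurable_funB; first exact: (measurableT_comp (measurable_Sx _ x) Hpi).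
  by apply: measurable_funM => //; exact: mW.
rewrite (_ : sup_deviation c x n =
  \bigcup_(q : rat) if 0 <= (ratr q : R) <= 1 then [set e | c < `|F (ratr q) e|] else set0).
  apply: countable_bigcupT_measurable; first exact: countableP.
  by move=> q; case: ifP => // _; exact: measurable_lt_norm.
apply/seteqP; split => [e /= [s [/andP[s0 s1] cs]]|e /= [q _]]; last first.
  by case: ifP => // q01 cq; exists (ratr q).
(* The endpoint 1 has no admissible time on its right, but it is rational itself. *)
have [s1'|] := ltP s 1; last first.
  move=> s1'; exists 1 => //; have -> : ratr 1 = s by rewrite rmorph1; apply/eqP; rewrite eq_le s1' s1.
  by rewrite s0 s1.
set k := Num.truncn (n%:R * s) in cs.
have ns0 : 0 <= n%:R * s by rewrite mulr_ge0.
have /andP[ks sk] := truncn_itv ns0; rewrite -/k in ks sk.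
pose D u := `|S k x (pi e) - v * W e u|.
have cD : D u @[u --> within [set u | 0 <= u] (nbhs (n%:R * s))] --> D (n%:R * s).
  apply: cvg_norm; apply: cvgB; first exact: cvg_cst.
  apply: cvgMr; move/subspace_continuousP: (cW e); exact.
have : \forall u \near within [set u | 0 <= u] (nbhs (n%:R * s)), c < D u.
  by apply: (cvgr_gt _ cD).
rewrite near_withinE => /nbhs_ballP[d /= d0 Hd].
(* A rational between [s] and [b] stays in the unit interval, lies in the neighbourhood given by
   continuity after scaling by [n], and has the same integer part [k] after scaling. *)
pose b := Num.min 1 (Num.min (s + d / n%:R) (k.+1%:R / n%:R)).
have sb : s < b.
  by rewrite !lt_min s1' ltrDl divr_gt0//= ltr_pdivlMr// mulrC.
have [q] := rat_in_itvoo sb; rewrite in_itv/= => /andP[sq].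
rewrite !lt_min => /and3P[q1 qd qk].
have q0 : 0 <= ratr q :> R by apply: le_trans s0 (ltW sq).
exists q => //; rewrite q0 (ltW q1) /=.
have -> : `|F (ratr q) e| = D (n%:R * ratr q).
  rewrite /F /D; congr (`|S _ _ _ - _|); apply: truncn_def.
  rewrite mulrC -ltr_pdivlMr// qk andbT mulrC.
  by apply: le_trans ks _; apply: ler_wpM2l => //; exact: ltW.
apply: Hd; last by rewrite /= mulr_ge0.
rewrite /ball/= distrC ger0_norm; last by rewrite subr_ge0 ler_wpM2l// ltW.
by rewrite -mulrBr mulrC -ltr_pdivlMr// ltrBlDl.
Qed.

Lemma wiener_marginal (r : R) (A : set R) : 0 < r -> measurable A ->
  PE [set e | A (W e r)] = normal_prob 0 (Num.sqrt r) A.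
Proof.
move=> r0 mA; case: HW => mW W0 cW incW.
have := incW 1%N (fun i => if i is 0 then 0 else r) (fun=> A).
rewrite big_ord1/= subr0 => <- //; last by case.
congr (PE _); apply/seteqP; split => e /=.
  by move=> Ae [] //= _; rewrite W0 subr0.
by move=> /(_ 0%N isT); rewrite W0 subr0.
Qed.

Hypothesis Hsap : forall eps : R, 0 < eps < 4^-1 ->
  exists c_eps : R, forall (x : X) (n : nat), (0 < n)%N ->
    (PE (sup_deviation (n%:R `^ (2^-1 - eps)) x n) <= (c_eps * n%:R `^ (- eps))%:E)%E.

(** The strong approximation is used at the single time s = 1 with exponent 1/8. Up to a probability
    of order r^(-1/8), the walk differs from the Wiener process by [rho], negligible against sqrt r;
    a window of width [eta] sqrt r thus becomes a slightly wider window for a gaussian of standard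
    deviation sqrt r. *)
Lemma anticoncentration (q : R) : 0 < q ->
  exists2 eta : R, 0 < eta & exists r0 : nat, forall r x (a : R), (0 < r)%N -> (r0 <= r)%N ->
    (P [set w | (a <= S r x w <= a + eta * Num.sqrt r%:R)%R] <= q%:E)%E.
Proof.
move=> q0.
have [c Hc] : exists c_eps : R, forall (x : X) (n : nat), (0 < n)%N ->
    (PE (sup_deviation (n%:R `^ (2^-1 - 8^-1)) x n) <= (c_eps * n%:R `^ (- 8^-1))%:E)%E.
  by apply: Hsap; lra.
(* Half of [q] is reserved for the two errors, the failure of the approximation and the widening of
   the window, both multiples of r^(-1/8). The absolute value is there because [c] may be
   negative. *)
pose d := q / 2 / (`|c| + 2 / v).
have K0 : 0 < `|c| + 2 / v by rewrite ltr_wpDl// divr_gt0.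
have d0 : 0 < d by rewrite !divr_gt0.
(* After division by [v] and by the standard deviation, this width accounts for the other half of
   [q]. *)
exists (q * v / 2); first by rewrite !(mulr_gt0, divr_gt0).
exists (Num.truncn (d ^- 8)).+1 => r x a r0 Hr.
have rR : 0 < r%:R :> R by rewrite ltr0n.
have sr0 : 0 < Num.sqrt r%:R :> R by rewrite sqrtr_gt0.
pose e8 : R := r%:R `^ (- 8^-1).
have e8d : e8 <= d.
  have dr : d ^- 8 <= r%:R.
    apply: (le_trans (ltW (truncnS_gt _))); by rewrite ler_nat.
  rewrite /e8 powRN -(@invrK _ d) lef_pV2 ?posrE ?invr_gt0 ?powR_gt0//.
  have -> : d^-1 = (d ^- 8) `^ 8^-1.
    rewrite -exprVn -powR_mulrn ?invr_ge0 ?(ltW d0)// -powRrM.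
    by rewrite divff ?powRr1 ?invr_ge0 ?(ltW d0).
  by apply: ge0_ler_powR; rewrite ?nnegrE ?invr_ge0 ?exprn_ge0 ?(ltW d0).
pose rho : R := r%:R `^ (2^-1 - 8^-1).
have rhoE : rho = Num.sqrt r%:R * e8.
  by rewrite /rho powRD ?powR12_sqrt// implybE (gt_eqF rR) orbT.
pose l := (q * v / 2 * Num.sqrt r%:R + 2 * rho) / v.
have rho0 : 0 <= rho by exact: powR_ge0.
have l0 : 0 <= l.
  by rewrite divr_ge0 ?(ltW Hv)// addr_ge0// mulr_ge0// ?(ltW sr0)// ?mulr_ge0 ?ltW.
have mS : measurable [set w | a <= S r x w <= a + q * v / 2 * Num.sqrt r%:R].
  by apply: measurable_between; exact: measurable_Sx.
rewrite -(Hpi_law mS).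
pose B := [set e | ((a - rho) / v <= W e r%:R <= (a - rho) / v + l)%R].
have BE : B = [set e | `[(a - rho) / v, ((a - rho) / v + l)%R]%classic (W e r%:R)].
  by apply/seteqP; split => e /=; rewrite in_itv.
have mB : measurable B.
  case: HW => mW _ _ _; rewrite BE.
  by rewrite -[X in measurable X]setTI; exact: mW.
have mD := measurable_sup_deviation rho x r0.
apply: (@le_trans _ _ (PE (sup_deviation rho x r `|` B))).
  apply: le_measure; rewrite ?inE.
  - by rewrite -[X in measurable X]setTI; exact: Hpi.
  - exact: measurableU.
  move=> e /= /andP[aS Sa].
  have [|le] := ltP rho `|S r x (pi e) - v * W e r%:R|.
    by move=> lt; left; exists 1; rewrite mulr1 natrK ler01 lexx.
  right; rewrite /B /= /l.
  move: le; rewrite ler_norml => /andP[le1 le2].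
  rewrite -mulrDl ler_pdivrMr// ler_pdivlMr// mulrC; apply/andP; split; lra.
apply: (@le_trans _ _ (PE (sup_deviation rho x r) + PE B)%E); first exact: measureU2.
rewrite BE (wiener_marginal rR)//.
apply: (@le_trans _ _ ((c * e8)%:E + (l / Num.sqrt r%:R)%:E)%E).
  by apply: leeD; [exact: Hc|exact: normal_prob_itv_le].
rewrite -EFinD lee_fin.
have -> : l / Num.sqrt r%:R = q / 2 + 2 / v * e8.
  by rewrite /l rhoE; field; rewrite !gt_eqF.
have e80 : 0 <= e8 by exact: powR_ge0.
have : c * e8 <= `|c| * e8 by rewrite ler_wpM2r// ler_norm.
have : (`|c| + 2 / v) * e8 <= q / 2.
  by rewrite -ler_pdivlMl// mulrC.
lra.
Qed.

End anticoncentration.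

(** * From one scale to the next *)

Section scale_step.
Variables (R : realType).
Variables (G : ptopologicalType) (mul : G -> G -> G) (one : G) (inv : G -> G).
Hypotheses (HG : topological_group mul one inv) (HGsp : sc_lc_space G).
Variables (mu : probability (borelT G) R).
Variables (P : probability (Omega G) R) (HP : is_product_measure mu P).
Variables (X : ptopologicalType) (act : G -> X -> X).
Hypotheses (Hact : continuous_action mul one act) (HXsp : sc_lc_space X).
Variables (nu : probability (borelT X) R).
Variables (sigma : G -> X -> R) (Hsigma : continuous_cocycle mul act sigma).

Local Notation U := (Omega G * borelT X)%type.
Local Notation Q := (P \x nu)%E.
Local Notation pos := (@pos G mul one X act).
Local Notation incr := (@incr R G mul one X act sigma).
Local Notation walk := (@walk R G mul one X sigma).
Local Notation Tit := (@Tit G mul one X act).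
Local Notation adapted := (@adapted G X).

(** Given the first [m] coordinates, the remaining [r] steps form a fresh walk from the current
    position, and the window is merely translated by the height reached. Uniformity of the
    hypothesis in starting point and window then allows integration over [H]. *)
Lemma adapted_anticoncentration (q l : R) (m r : nat) (a : R) (H : set U) :
  (forall x b, P [set w | (b <= Sx mul one sigma x r w <= b + l)%R] <= q%:E)%E ->
  measurable H -> adapted m H ->
  (Q (H `&` [set u | (a <= walk (r + m)%N u <= a + l)%R]) <= q%:E * Q H)%E.
Proof.
move=> conc mH aH.
have mw := measurable_walk HG HGsp Hact HXsp Hsigma.
have q0 : 0 <= q by rewrite -lee_fin; apply: le_trans (conc point 0); exact: measure_ge0.
have mI : measurable (H `&` [set u | a <= walk (r + m)%N u <= a + l]).
  by apply: measurableI => //; exact: measurable_between.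
rewrite -integral_indicT//.
apply: (@le_trans _ _ (\int[Q]_u (q%:E * (\1_H u)%:E))%E); last first.
  rewrite ge0_integralZl//; last by apply/measurable_EFinP; exact: measurable_indic.
  by rewrite integral_indicT.
apply: (le_integral_cond HP nu (m := m)).
- by apply/measurable_EFinP; exact: measurable_indic.
- by move=> u; rewrite lee_fin.
move=> w x.
have spl w' i : (i < m)%N -> w i = splice m w w' i.
  by move=> im; rewrite /Defs.splice im.
have [Hw|nHw] := pselect (H (w, x)); last first.
  rewrite integral0_eq; first by rewrite mule_ge0 ?lee_fin.
  move=> w' _; rewrite indicE memNset// => -[Hs _]; apply: nHw.
  by apply: aH Hs => i im; rewrite -spl.
rewrite [X in (_ * X)%E](_ : _ = 1%E) ?mule1; last by rewrite indicE mem_set.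
pose y := pos m (w, x); pose b := a - walk m (w, x).
apply: le_trans (conc y b).
have mS : measurable [set w : Omega G | b <= Sx mul one sigma y r w <= b + l].
  by apply: measurable_between; exact: (measurable_Sx HG HGsp Hact HXsp Hsigma).
rewrite -(shift_law HP m mS) -integral_indicT; last first.
  by rewrite -[X in measurable X]setTI; exact: measurable_shift.
apply: ge0_le_integralT_nonmeas => w'; first by rewrite lee_fin.
rewrite lee_fin !indicE; case: (boolP (_ \in _)) => //; rewrite inE => -[_ /=].
rewrite (walkD HG Hsigma) /b => aw.
rewrite mem_set//= /y.
have wm : wshift m (splice m w w') = wshift m w'.
  by apply/funext => i; rewrite /wshift /Defs.splice ltnNge leq_addl.
have -> : Sx mul one sigma (pos m (w, x)) r (wshift m w') =
    walk r (Tit m (splice m w w', x)).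
  by rewrite (pos_ext mul one act x (spl w')) -wm.
rewrite (walk_ext mul one sigma x (spl w')).
by move: aw => /andP[aw1 aw2]; apply/andP; split; lra.
Qed.

Variables (L tau : R) (L0 : 0 <= L) (tau0 : 0 <= tau).
Hypothesis Hint : forall y, mu.-integrable setT (fun g => (sigma g y)%:E).
Hypothesis Hcent : centered mu sigma.
Hypothesis Htau : forall y, (\int[mu]_g (tail L (sigma g y))%:E <= tau%:E)%E.

Variable t : R.
Local Notation Z := (fun k u => t + walk k u).
Local Notation posmass A N := (\int[Q]_u (\1_A u * Num.max (Z N u) 0)%:E)%E.

Variables (A A' B : set U) (N p N' : nat).
Hypotheses (mA : measurable A) (mA' : measurable A') (mB : measurable B).
Hypotheses (aA : adapted (N + p)%N A) (NN' : (N + p <= N')%N).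
Hypothesis A'sub : forall u, A' u -> B u \/
  A u /\ forall k, (N + p <= k <= N')%N -> - L <= Z k u.

Variables (Va Pa Pb : R).
Hypotheses (HVa : (posmass A N <= Va%:E)%E) (HPa : (Q A <= Pa%:E)%E)
  (HPb : (Q B <= Pb%:E)%E).

Let mw k : measurable_fun setT (walk k) := measurable_walk HG HGsp Hact HXsp Hsigma k.

Let mZ k : measurable_fun setT (Z k).
Proof. exact: measurable_funD. Qed.

Let mI (S : set U) : measurable S -> measurable_fun setT (\1_S : U -> R).
Proof. exact: measurable_indic. Qed.

Let mpos S k : measurable S -> measurable_fun setT (fun u => \1_S u * Num.max (Z k u) 0).
Proof.
by move=> mS; apply: measurable_funM; [exact: mI|exact: measurable_maxr].
Qed.

Let pos_ge0 (S : set U) k u : 0 <= \1_S u * Num.max (Z k u) 0.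
Proof. by rewrite mulr_ge0// le_max lexx orbT. Qed.

(** The positive part of the height is at most the positive part of [t] plus the displacement since
    time 0. This crude bound serves on exceptional events and also starts the multiscale
    recursion. *)
Lemma posmass_bad k : (posmass B k <= ((Num.max t 0 + k%:R * L) * Pb + k%:R * tau)%:E)%E.
Proof.
have t0 : 0 <= Num.max t 0 by rewrite le_max lexx orbT.
apply: (@le_trans _ _ (\int[Q]_u ((Num.max t 0)%:E * (\1_B u)%:E +
    (\1_B u * `|walk (0 + k)%N u - walk 0 u|)%:E))%E).
  apply: ge0_le_integralT_nonmeas => u; first by rewrite lee_fin.
  rewrite -EFinM -EFinD lee_fin (walk0 HG Hact Hsigma) subr0 add0n.
  rewrite [Num.max t 0 * _]mulrC -mulrDr ler_wpM2l//.
  rewrite ge_max addr_ge0// andbT lerD ?le_max ?lexx//.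
  exact: ler_norm.
rewrite ge0_integralD//; first last.
- apply/measurable_EFinP; apply: measurable_funM; first exact: mI.
  by apply: measurableT_comp => //; exact: measurable_funB.
- by apply: measurable_funeM; apply/measurable_EFinP; exact: mI.
- by move=> u _; rewrite -EFinM lee_fin mulr_ge0.
rewrite [leRHS](_ : _ = ((Num.max t 0 * Pb)%:E + (k%:R * L * Pb + k%:R * tau)%:E)%E); last first.
  by rewrite -EFinD mulrDl addrA.
apply: leeD.
  rewrite ge0_integralZl//; last by apply/measurable_EFinP; exact: mI.
  by rewrite integral_indicT// EFinM lee_wpmul2l.
apply: le_trans (walk_oscillation HG HGsp HP Hact HXsp nu Hsigma L0 Htau 0 k mB) _.
rewrite [leRHS]EFinD; apply: leeD => //; rewrite [leRHS]EFinM.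
by apply: lee_wpmul2l => //; rewrite lee_fin mulr_ge0.
Qed.

(** The event [A] is known only at time [N + p], so the supermartingale starts there. The [p] steps
    from [N] on are paid for by the oscillation of the walk on [A], and the offset [2 * L] of the
    payoff by a multiple of [Pa]. *)
Lemma posmass_good : (\int[Q]_u (\1_(alive mul one sigma L t A (N + p) (N' - (N + p))) u *
      (Z N' u + 2 * L))%:E
   <= (Va + (2 + p%:R) * L * Pa + (p + N')%N%:R * tau)%:E)%E.
Proof.
have := killed_walk_bound HG HGsp HP Hact HXsp nu Hsigma L0 tau0 Hint Hcent Htau t
  (N' - (N + p))%N mA aA.
rewrite subnKC// => /le_trans; apply.
apply: (@le_trans _ _ ((Va + (2 + p%:R) * L * Pa + p%:R * tau)%:E +
    ((N' - (N + p))%:R * tau)%:E)%E); last first.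
  rewrite -EFinD lee_fin natrD mulrDl.
  have : (N' - (N + p))%:R * tau <= N'%:R * tau by rewrite ler_wpM2r// ler_nat leq_subr.
  lra.
apply: leeD => //.
apply: (@le_trans _ _ (\int[Q]_u ((\1_A u * Num.max (Z N u) 0)%:E +
    (2 * L * \1_A u)%:E + (\1_A u * `|walk (N + p)%N u - walk N u|)%:E))%E).
  apply: ge0_le_integralT_nonmeas => u.
    rewrite lee_fin indicE; case: (boolP (_ \in _)); rewrite ?mul0r// inE mul1r.
    by move=> /alive_last; rewrite addn0; have := L0; lra.
  rewrite -!EFinD lee_fin [\1_(alive _ _ _ _ _ _ _ _) u]indicE.
  case: (boolP (_ \in _)) => [|_]; last first.
    by rewrite mul0r !addr_ge0// !mulr_ge0.
  rewrite inE => -[Au _]; rewrite indicE mem_set// !mul1r mulr1.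
  have : Z N u <= Num.max (Z N u) 0 by rewrite le_max lexx.
  have := ler_norm (walk (N + p)%N u - walk N u); lra.
have mosc : measurable_fun setT (fun u => \1_A u * `|walk (N + p)%N u - walk N u|).
  apply: measurable_funM; first exact: mI.
  by apply: measurableT_comp => //; exact: measurable_funB.
have mLA : measurable_fun setT (fun u : U => 2 * L * \1_A u).
  by apply: measurable_funM => //; exact: mI.
rewrite ge0_integralD//; first last.
- exact/measurable_EFinP.
- by apply: emeasurable_funD; apply/measurable_EFinP => //; exact: mpos.
- by move=> u _; rewrite -EFinD lee_fin addr_ge0// !mulr_ge0.
rewrite ge0_integralD//; first last.
- exact/measurable_EFinP.
- by move=> u _; rewrite lee_fin !mulr_ge0.
- by apply/measurable_EFinP; exact: mpos.
- by move=> u _; rewrite lee_fin.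
rewrite (_ : Va + _ + _ = Va + 2 * L * Pa + (p%:R * L * Pa + p%:R * tau)); last by ring.
rewrite !EFinD; apply: leeD.
  apply: leeD => //.
  under eq_integral do rewrite EFinM.
  rewrite ge0_integralZl//; first last.
  - by rewrite lee_fin mulr_ge0.
  - by apply/measurable_EFinP; exact: mI.
  rewrite integral_indicT// [leRHS]EFinM; apply: lee_wpmul2l => //.
  by rewrite lee_fin mulr_ge0.
apply: le_trans (walk_oscillation HG HGsp HP Hact HXsp nu Hsigma L0 Htau N p mA) _.
apply: leeD => //; rewrite [leRHS]EFinM.
by apply: lee_wpmul2l => //; rewrite lee_fin mulr_ge0.
Qed.

(** Outside [B], the event [A'] is contained in the survival of the killed walk up to [N'], where
    the height is at least [- L] and its positive part is therefore below the payoff. On [B] the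
    crude bound applies. *)
Lemma scale_mass : (posmass A' N' <= (Va + (2 + p%:R) * L * Pa +
   (Num.max t 0 + N'%:R * L) * Pb + (3 * N')%N%:R * tau)%:E)%E.
Proof.
set D := alive mul one sigma L t A (N + p) (N' - (N + p)).
have mD : measurable D by exact: (measurable_alive HG HGsp Hact HXsp Hsigma).
have D0 u : 0 <= \1_D u * (Z N' u + 2 * L).
  rewrite indicE; case: (boolP (_ \in _)); rewrite ?mul0r// inE mul1r.
  by move=> /alive_last; rewrite subnKC//; have := L0; lra.
apply: (@le_trans _ _ (\int[Q]_u ((\1_D u * (Z N' u + 2 * L))%:E +
    (\1_B u * Num.max (Z N' u) 0)%:E))%E).
  apply: ge0_le_integralT_nonmeas => u; first by rewrite lee_fin.
  rewrite -EFinD lee_fin [\1_A' u]indicE; case: (boolP (_ \in _)); last first.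
    by rewrite mul0r addr_ge0.
  rewrite inE mul1r => /A'sub [Bu|[Au AZ]].
    by rewrite [\1_B u]indicE mem_set// mul1r lerDr.
  have Du : D u.
    by apply: alive_intro => // i; rewrite subnKC//; exact: AZ.
  apply: (@le_trans _ _ (\1_D u * (Z N' u + 2 * L))); last by rewrite lerDl.
  rewrite indicE mem_set// mul1r ge_max.
  have := alive_last Du; rewrite subnKC//; have := L0.
  by move=> ? ?; apply/andP; split; lra.
have mDZ : measurable_fun setT (fun u => \1_D u * (Z N' u + 2 * L)).
  by apply: measurable_funM; [exact: mI|exact: measurable_funD].
rewrite ge0_integralD//; try by
  [apply/measurable_EFinP|apply/measurable_EFinP; exact: mpos
  |move=> u _; rewrite lee_fin].
apply: le_trans (leeD posmass_good (posmass_bad N')) _.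
rewrite -EFinD lee_fin natrD natrM.
have : p%:R * tau <= N'%:R * tau.
  by rewrite ler_wpM2r// ler_nat (leq_trans _ NN')// leq_addl.
lra.
Qed.

(** Outside [B], either the final height is at least [h], which Markov's inequality controls by the
    positive mass, or it lies between [- L] and [h]. The latter is a window of width [L + h] for the
    steps after time [N + p], conditionally on [A]. *)
Lemma scale_prob (q h : R) : 0 < h ->
  (forall x b, P [set w | (b <= Sx mul one sigma x (N' - (N + p)) w <= b + (L + h))%R] <= q%:E)%E ->
  forall Va', (posmass A' N' <= Va'%:E)%E ->
  (Q A' <= (Pb + Va' / h + q * Pa)%:E)%E.
Proof.
move=> h0 conc Va' HVa'.
pose C := A `&` [set u | (- L - t <= walk (N' - (N + p) + (N + p))%N u <= - L - t + (L + h))%R].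
pose S := A' `&` [set u | h <= Z N' u].
have q0 : 0 <= q by rewrite -lee_fin; apply: le_trans (conc point 0); exact: measure_ge0.
have mC : measurable C.
  by apply: measurableI => //; exact: measurable_between.
have mS : measurable S by apply: measurableI => //; apply: measurable_le_fun.
have cover : A' `<=` B `|` S `|` C.
  move=> u A'u; have [Bu|[Au AZ]] := A'sub A'u; first by left; left.
  have [hZ|Zh] := leP h (Z N' u); first by left; right.
  right; split => //=; rewrite subnK//.
  by have := AZ N'; rewrite NN' leqnn => /(_ isT); move: Zh => /ltW ? ?; apply/andP; split; lra.
apply: (@le_trans _ _ (Q (B `|` S `|` C))).
  by apply: le_measure; rewrite ?inE//; do 2 apply: measurableU => //.
apply: (@le_trans _ _ (Q B + Q S + Q C)%E).
  apply: (le_trans (measureU2 _ _ _)) => //; first exact: measurableU.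
  by apply: leeD => //; exact: measureU2.
rewrite !EFinD; apply: leeD; first apply: leeD => //.
  rewrite [leRHS](_ : _ = (h^-1%:E * Va'%:E)%E); last by rewrite -EFinM mulrC.
  apply: (@le_trans _ _ (h^-1%:E * posmass A' N')%E); last first.
    by apply: lee_wpmul2l => //; rewrite lee_fin invr_ge0 ltW.
  rewrite -ge0_integralZl//; first last.
  - by rewrite lee_fin invr_ge0 ltW.
  - by move=> u _; rewrite lee_fin.
  - by apply/measurable_EFinP; exact: mpos.
  rewrite -integral_indicT//; apply: ge0_le_integralT_nonmeas => u; first by rewrite lee_fin.
  rewrite -EFinM lee_fin indicE; case: (boolP (_ \in _)) => [|_]; last first.
    by rewrite mulr_ge0// invr_ge0 ltW.
  rewrite inE => -[A'u hZ]; rewrite indicE mem_set// mul1r ler_pdivlMl// mulr1.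
  by rewrite le_max hZ.
apply: le_trans (adapted_anticoncentration _ conc mA aA) _.
by rewrite EFinM; apply: lee_wpmul2l.
Qed.

End scale_step.

(** * Perturbations depending on the future *)

Section perturbation.
Variables (R : realType).
Variables (G : ptopologicalType) (mul : G -> G -> G) (one : G) (inv : G -> G).
Hypotheses (HG : topological_group mul one inv) (HGsp : sc_lc_space G).
Variables (mu : probability (borelT G) R).
Variables (P : probability (Omega G) R) (HP : is_product_measure mu P).
Variables (X : ptopologicalType) (act : G -> X -> X).
Hypotheses (Hact : continuous_action mul one act) (HXsp : sc_lc_space X).
Variables (nu : probability (borelT X) R) (Hnu : stationary act mu nu).
Variables (sigma : G -> X -> R) (Hsigma : continuous_cocycle mul act sigma).

Local Notation U := (Omega G * borelT X)%type.
Local Notation Q := (P \x nu)%E.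
Local Notation walk := (@walk R G mul one X sigma).
Local Notation Tit := (@Tit G mul one X act).
Local Notation adapted := (@adapted G X).

Variables (f : nat -> Omega G -> borelT X -> R).
Hypothesis mf : forall k, measurable_fun [set: Omega G * borelT X] (fun p => f k p.1 p.2).

Definition past (k p : nat) (u : U) : R := condexp_past P (fun w' => f k w' u.2) p u.1.
Definition value (k : nat) (u : U) : R := f k u.1 u.2.

Lemma past_ext k p (w w' : nat -> G) x : (forall i, (i < p)%N -> w i = w' i) ->
  past k p (w, x) = past k p (w', x).
Proof.
move=> e; rewrite /past /condexp_past /=; congr fine; apply: eq_integral => z _.
congr (f k _ x)%:E; apply/funext => i; rewrite /Defs.splice.
by case: ifP => // /e.
Qed.

(** The integral in [condexp_past] is the difference of the integrals of the positive and negative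
    parts, each measurable in the parameters by Tonelli; [fine] is then applied to an extended real
    function. *)
Lemma measurable_past k p : measurable_fun setT (past k p).
Proof.
pose g (z : U * Omega G) : \bar R := (f k (splice p z.1.1 z.2) z.1.2)%:E.
have mg : measurable_fun setT g.
  apply/measurable_EFinP.
  apply: (measurableT_comp (mf k)
    (g := fun z : U * Omega G => (splice p z.1.1 z.2 : Omega G, z.1.2))).
  apply: measurable_fun_pair.
    apply: (measurableT_comp (measurable_splice p)
      (g := fun z : U * Omega G => (z.1.1, z.2))).
    apply: measurable_fun_pair; last exact: measurable_snd.
    by apply: measurableT_comp; [exact: measurable_fst|exact: measurable_fst].
  by apply: measurableT_comp; [exact: measurable_snd|exact: measurable_fst].
apply: (measurableT_comp (fine_measurable measurableT)).
apply: (eq_measurable_fun (fun u => (\int[P]_w' (g^\+ (u, w')) - \int[P]_w' (g^\- (u, w')))%E)).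
  move=> u _; rewrite [RHS]integralE; congr (_ - _)%E; apply: eq_integral => w' _.
    by rewrite !funeposE.
  by rewrite !funenegE.
apply: emeasurable_funB.
  by apply: (measurable_fun_fubini_tonelli_F (g^\+)%E) => //; exact: measurable_funepos.
by apply: (measurable_fun_fubini_tonelli_F (g^\-)%E) => //; exact: measurable_funeneg.
Qed.

Definition bad1 (k p : nat) (d l : R) : set U :=
  [set u | d < `|value k u - past k p u|] `|` [set u | l < `|value k u|].

(** The index 0 is included because the term at time 0 is approximated as well. *)
Definition bad (p N : nat) (d l : R) : set U :=
  \big[setU/set0]_(k < N.+1) (Tit k @^-1` bad1 k p d l).

Variable t : R.

Definition survive (p N : nat) (s : R) : set U :=
  [set u | forall k, (1 <= k <= N)%N ->
     - s <= t + walk k u + past k p (Tit k u) - past 0 p u].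

Lemma notbadP p N d l u : ~ bad p N d l u -> forall k, (k <= N)%N ->
  `|value k (Tit k u) - past k p (Tit k u)| <= d /\ `|value k (Tit k u)| <= l.
Proof.
move=> nb k kN; apply: contrapT => /not_andP h; apply: nb.
rewrite /bad -(bigcup_mkord N.+1 (fun k => Tit k @^-1` bad1 k p d l)).
exists k => //=; rewrite /bad1/=.
by case: h => /negP; rewrite -ltNge => h; [left|right].
Qed.

Lemma Tit0 u : Tit 0 u = u.
Proof.
rewrite /Tit /Titer /=; case: Hact => -> _ _; case: u => w x /=.
by congr pair; apply/funext => i; rewrite addn0.
Qed.

(** The slack pays for two replacements by conditional expectations, one at time [k] and one at time
    0. *)
Lemma survive_init p N s d l u : 2 * d <= s ->
  (forall k, (1 <= k <= N)%N -> 0 <= t + walk k u + value k (Tit k u) - value 0 u) ->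
  bad p N d l u \/ survive p N s u.
Proof.
move=> ds h; have [|nb] := pselect (bad p N d l u); first by left.
right=> k kN; have := h k kN.
have /andP[_ kN'] := kN.
have [] := notbadP nb kN'; have [] := notbadP nb (leq0n N); rewrite Tit0.
rewrite !ler_norml => /andP[? ?] _ /andP[? ?] _ ?; lra.
Qed.

(* The slacks must decrease from one scale to the next to absorb the two
   approximation errors. *)
Lemma survive_mono p p' N N' s s' d d' l l' u : (N <= N')%N -> s' + 2 * d + 2 * d' <= s ->
  survive p' N' s' u -> (bad p N d l `|` bad p' N' d' l') u \/ survive p N s u.
Proof.
move=> NN' ds h; have [|nb] := pselect (bad p N d l u); first by left; left.
have [|nb'] := pselect (bad p' N' d' l' u); first by left; right.
right=> k kN; have /andP[k1 kN'] := kN; have kNN := leq_trans kN' NN'.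
have := h k; rewrite k1 kNN => /(_ isT).
have [] := notbadP nb kN'; have [] := notbadP nb (leq0n N).
have [] := notbadP nb' kNN; have [] := notbadP nb' (leq0n N'); rewrite Tit0.
rewrite !ler_norml => /andP[? ?] _ /andP[? ?] _ /andP[? ?] _ /andP[? ?] _; lra.
Qed.

(** Off the bad event a conditional expectation is at most [d + l] in absolute value, and two of
    them are removed. *)
Lemma survive_ge p N s d l u : survive p N s u ->
  bad p N d l u \/ forall k, (1 <= k <= N)%N -> - (s + 2 * d + 2 * l) <= t + walk k u.
Proof.
move=> h; have [|nb] := pselect (bad p N d l u); first by left.
right=> k kN; have /andP[_ kN'] := kN; have := h k kN.
have [] := notbadP nb kN'; have [] := notbadP nb (leq0n N); rewrite Tit0.
rewrite !ler_norml => /andP[? ?] /andP[? ?] /andP[? ?] /andP[? ?]; lra.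
Qed.

(** After [k] shifts, the conditional expectation on [p] coordinates reads the coordinates from [k]
    to [k + p - 1], all below [N + p]. *)
Lemma adapted_survive p N s : adapted (N + p)%N (survive p N s).
Proof.
move=> w w' x e h k kN; have /andP[_ kN'] := kN.
have := h k kN.
rewrite (walk_ext mul one sigma (w' := w')); last first.
  by move=> i ik; apply: e; rewrite (leq_trans ik)// (leq_trans kN')// leq_addr.
rewrite (past_ext 0 (w' := w')); last first.
  by move=> i ip; apply: e; rewrite (leq_trans ip)// leq_addl.
congr (_ <= _ + _ - _); rewrite /Tit /Titer /=.
rewrite (gprod_ext mul one (w' := w')); last first.
  by move=> i ik; apply: e; rewrite (leq_trans ik)// (leq_trans kN')// leq_addr.
apply: past_ext => i ip; apply: e.
by rewrite addnC (leq_ltn_trans (leq_add kN' (leqnn i)))// ltn_add2l.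
Qed.

Lemma measurable_survive p N s : measurable (survive p N s).
Proof.
rewrite (_ : survive p N s = \bigcap_(k in [set k | (1 <= k <= N)%N])
    [set u | - s <= t + walk k u + past k p (Tit k u) - past 0 p u]); last first.
  by apply/seteqP; split.
apply: bigcap_measurableType => k _; apply: measurable_le_fun.
apply: measurable_funB; last exact: measurable_past.
apply: measurable_funD.
  apply: measurable_funD => //.
  exact: (measurable_walk HG HGsp Hact HXsp Hsigma).
apply: (measurableT_comp (measurable_past k p)).
exact: (measurable_Tit HGsp Hact HXsp).
Qed.

Lemma measurable_bad1 k p d l : measurable (bad1 k p d l).
Proof.
apply: measurableU; apply: measurable_lt_norm; last exact: mf.
by apply: measurable_funB; [exact: mf|exact: measurable_past].
Qed.

Lemma measurable_Tit_bad1 k p d l : measurable (Tit k @^-1` bad1 k p d l).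
Proof.
rewrite -[X in measurable X]setTI.
by apply: (measurable_Tit HGsp Hact HXsp) => //; exact: measurable_bad1.
Qed.

Lemma measurable_bad p N d l : measurable (bad p N d l).
Proof. by apply: bigsetU_measurable => k _; exact: measurable_Tit_bad1. Qed.

Variables (alpha beta Bnd : R) (Halpha : 0 < alpha) (Hbeta : 0 < beta) (HB : 1 <= Bnd).
Hypothesis HC : forall k, (\int[nu]_x \int[P]_w (expR (alpha * `|f k w x|))%:E <= Bnd%:E)%E.
Hypothesis HD : forall k p : nat,
  ((expR (beta * p%:R))%:E * (\int[nu]_x \int[P]_w
     (expR (alpha * `|f k w x - condexp_past P (fun w' => f k w' x) p w|))%:E - 1%E)
   <= Bnd%:E)%E.

(** The indicator is compared through 1 + alpha d 1_{|g| > d} <= exp(alpha |g|), so that only the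
    excess [c] of the moment over 1 enters the bound. The excess is what decays with [p] in the
    assumption on conditional expectations; the moment itself does not. *)
Lemma exp_markov_sub1 (g : U -> R) (d c : R) : measurable_fun setT g -> 0 < d ->
  (\int[Q]_u (expR (alpha * `|g u|))%:E <= (1 + c)%:E)%E ->
  (Q [set u | (d < `|g u|)%R] <= (c / (alpha * d))%:E)%E.
Proof.
move=> mg d0 le.
have ad : 0 < alpha * d by rewrite mulr_gt0.
have mS : measurable [set u | d < `|g u|] by exact: measurable_lt_norm.
have : (1%:E + (alpha * d)%:E * Q [set u | (d < `|g u|)%R] <= (1 + c)%:E)%E.
  apply: le_trans le; rewrite -(probability_integral_cst Q 1%:E) -integral_indicT//.
  have mI : measurable_fun setT (fun u => (\1_[set u | d < `|g u|] u)%:E : \bar R).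
    by apply/measurable_EFinP; exact: measurable_indic.
  rewrite -ge0_integralZl//; last by rewrite lee_fin ltW.
  rewrite -ge0_integralD//; try by
    [apply: measurable_funeM|move=> u _; rewrite -EFinM lee_fin mulr_ge0 ?(ltW ad)].
  apply: ge0_le_integralT_nonmeas => u.
    by rewrite adde_ge0 ?mule_ge0 ?lee_fin// ltW.
  rewrite -EFinM -EFinD lee_fin; apply: le_trans (expR_ge1Dx _); rewrite lerD2l -mulrA.
  rewrite ler_pM2l//; rewrite indicE; case: (boolP (_ \in _)); rewrite ?mulr0// inE mulr1.
  exact: ltW.
have Qfin : Q [set u | d < `|g u|] \is a fin_num.
  by exact: (@fin_num_measure _ _ _ (Q : probability U R)).
rewrite -(fineK Qfin) -EFinM -EFinD !lee_fin lerD2l => h.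
by rewrite ler_pdivlMr// mulrC.
Qed.

(* Markov's inequality for exp (alpha |f - F|) - 1 >= alpha y on one side, for
   exp (alpha |f|) on the other. *)
Definition bad_rate (x y z : R) : R :=
  Bnd * expR (- beta * x) / (alpha * y) + Bnd * expR (- alpha * z).

Lemma bad1_le k p d l : 0 < d -> (Q (bad1 k p d l) <= (bad_rate p%:R d l)%:E)%E.
Proof.
move=> d0; have mv : measurable_fun setT (value k) by exact: mf.
have mvp : measurable_fun setT (fun u => value k u - past k p u).
  by apply: measurable_funB => //; exact: measurable_past.
have mexp (g : U -> R) : measurable_fun setT g ->
    measurable_fun setT (fun u => (expR (alpha * `|g u|))%:E : \bar R).
  move=> mg; apply/measurable_EFinP; apply: (measurableT_comp (@measurable_expR R)).
  by apply: measurable_funM => //; exact: measurableT_comp.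
apply: (le_trans (measureU2 _ _ _)); [exact: measurable_lt_norm|exact: measurable_lt_norm|].
rewrite /bad_rate EFinD; apply: leeD.
  apply: exp_markov_sub1 => //.
  rewrite (integral_iter _ _ (mexp _ mvp)); last by move=> u; rewrite lee_fin expR_ge0.
  have := HD k p; rewrite /value /past /=; set I := (\int[nu]_x _)%E => HDk.
  have e0 : 0 < expR (beta * p%:R) :> R by exact: expR_gt0.
  have I0 : (0 <= I)%E.
    by apply: integral_ge0 => x _; apply: integral_ge0 => w _; rewrite lee_fin expR_ge0.
  have -> : Bnd * expR (- beta * p%:R) = Bnd / expR (beta * p%:R).
    by rewrite mulNr expRN.
  (* An infinite integral would make the left side of [HDk] infinite, so only the finite case has
     content. *)
  move: HDk I0; case: I => [r| |]//=.
    rewrite -EFinB -EFinM !lee_fin => HDk _.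
    by rewrite -lerBlDl ler_pdivlMr// mulrC.
  by rewrite addye// gt0_muley ?lte_fin.
have mf' : measurable [set u | l < `|value k u|] by exact: measurable_lt_norm.
apply: (@le_trans _ _ (\int[Q]_u (\1_[set u | (l < `|value k u|)%R] u)%:E)%E).
  by rewrite integral_indicT.
apply: (@le_trans _ _ (\int[Q]_u ((expR (- alpha * l))%:E * (expR (alpha * `|value k u|))%:E))%E).
  apply: ge0_le_integralT_nonmeas => u; first by rewrite lee_fin.
  rewrite -EFinM lee_fin -expRD.
  rewrite indicE; case: (boolP (_ \in _)) => [|_]; last exact: expR_ge0.
  rewrite inE /= => lu; rewrite -[leLHS]expR0 ler_expR mulNr addrC -mulrBr.
  by rewrite mulr_ge0 ?subr_ge0 ?ltW.
rewrite ge0_integralZl//; try by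
  [exact: mexp|rewrite lee_fin expR_ge0|move=> u _; rewrite lee_fin expR_ge0].
rewrite [Bnd * _]mulrC [leRHS]EFinM; apply: lee_wpmul2l; first by rewrite lee_fin expR_ge0.
rewrite (integral_iter _ _ (mexp _ mv)); last by move=> u; rewrite lee_fin expR_ge0.
exact: HC.
Qed.

(** A union bound over the [N.+1] times; since [Q] is invariant under [Tit k], each term is bounded
    as at time 0. *)
Lemma bad_le p N d l : 0 < d -> (Q (bad p N d l) <= (N.+1%:R * bad_rate p%:R d l)%:E)%E.
Proof.
move=> d0.
apply: (@le_trans _ _ (\sum_(k < N.+1) Q (Tit k @^-1` bad1 k p d l))%E).
  apply: (Boole_inequality Q (A := fun k => Tit k @^-1` bad1 k p d l)) => k _.
  exact: measurable_Tit_bad1.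
apply: (@le_trans _ _ (\sum_(k < N.+1) (bad_rate p%:R d l)%:E)%E).
  apply: lee_sum => k _; rewrite (Tit_law HG HGsp HP Hact HXsp Hnu)//; first exact: bad1_le.
  exact: measurable_bad1.
by rewrite sumEFin lee_fin sumr_const card_ord mulr_natl.
Qed.

End perturbation.

(** The exponential is at least a single term of its series. The exponent obtained is [k.+1]. *)
Lemma expR_decay (R : realType) (c : R) (k : nat) : 0 < c ->
  exists2 C : R, 0 < C & forall x, 0 < x -> expR (- c * x) <= C / x ^+ k.+1.
Proof.
move=> c0; exists (k.+1`!%:R / c ^+ k.+1).
  by rewrite divr_gt0 ?exprn_gt0// ltr0n fact_gt0.
move=> x x0; have cx0 : 0 < c * x by rewrite mulr_gt0.
have f0 : 0 < k.+1`!%:R :> R by rewrite ltr0n fact_gt0.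
have h : (c * x) ^+ k.+1 / k.+1`!%:R <= expR (c * x).
  by apply: le_trans (expR_ge1Dxn k (ltW cx0)); rewrite lerDr.
rewrite mulNr expRN -[leRHS]invrK lef_pV2 ?posrE ?expR_gt0 ?invr_gt0 ?divr_gt0 ?exprn_gt0//.
apply: le_trans h; rewrite exprMn !invfM !invrK.
by rewrite -mulrA mulrC.
Qed.

(** * Arithmetic of the two recursions *)

Section scale_arithmetic.
Variable (R : realType).

(** The bound of [scale_mass] with p = x, L = 2x, N' = 64 x^6, bad probability 2K/x^9 and tail
    K/x^9. The term in [Pa] is a relative error at most 4 K1/x as x >= 2; the others are at most 2 K
    tp/x, 256 K/x and 192 K/x, whence 450 = 2 + 256 + 192. *)
Lemma mass_recursion (K K1 th tp w x : R) : 0 < K -> 0 <= K1 -> 0 <= tp -> th = 1 + tp ->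
  1 <= w -> 2 <= x ->
  th * w + (2 + x) * (2 * x) * (K1 * th * w / x ^+ 3) +
    (tp + 64 * x ^+ 6 * (2 * x)) * (2 * K / x ^+ 9) + 3 * (64 * x ^+ 6) * (K / x ^+ 9)
  <= th * w * (1 + (4 * K1 + 450 * K) / x).
Proof.
move=> K0 K10 tp0 thE w1 x2.
have x0 : 0 < x by lra.
pose y := x^-1; have y0 : 0 < y by rewrite invr_gt0.
have y12 : y <= 1 / 2.
  by rewrite /y -[1 / 2]invrK lef_pV2 ?posrE//; lra.
have -> : th * w + (2 + x) * (2 * x) * (K1 * th * w / x ^+ 3) +
    (tp + 64 * x ^+ 6 * (2 * x)) * (2 * K / x ^+ 9) + 3 * (64 * x ^+ 6) * (K / x ^+ 9) =
    th * w + (4 * y ^+ 2 + 2 * y) * (K1 * (th * w)) + 2 * K * tp * y ^+ 9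
      + 256 * K * y ^+ 2 + 192 * K * y ^+ 3.
  by rewrite /y; field; rewrite gt_eqF.
rewrite -/y.
have thw : th <= th * w by rewrite ler_peMr//; lra.
have yn n : y ^+ n.+1 <= y.
  by rewrite exprS ler_piMr ?(ltW y0)// exprn_ile1 ?(ltW y0)//; lra.
have y2 : 4 * y ^+ 2 + 2 * y <= 4 * y.
  have : y ^+ 2 <= 1 / 2 * y by rewrite expr2 ler_wpM2r// ltW.
  lra.
have h1 : (4 * y ^+ 2 + 2 * y) * (K1 * (th * w)) <= 4 * y * (K1 * (th * w)).
  by rewrite ler_wpM2r// !mulr_ge0//; lra.
have h2 : 2 * K * tp * y ^+ 9 <= 2 * K * tp * y.
  by rewrite ler_wpM2l// !mulr_ge0//; lra.
have h3 : 256 * K * y ^+ 2 <= 256 * K * y.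
  by apply: ler_wpM2l; [apply: mulr_ge0; [exact: ler0n|exact: ltW]|exact: yn].
have h4 : 192 * K * y ^+ 3 <= 192 * K * y.
  by apply: ler_wpM2l; [apply: mulr_ge0; [exact: ler0n|exact: ltW]|exact: yn].
have h5 : 450 * K * y * th <= 450 * K * y * (th * w).
  apply: ler_wpM2l; last exact: thw.
  by apply: mulr_ge0 (ltW y0); apply: mulr_ge0; [exact: ler0n|exact: ltW].
have h6 : 2 * K * tp * y + 256 * K * y + 192 * K * y <= 450 * K * y * th.
  have Ky : 0 <= K * y by rewrite mulr_ge0// ltW.
  rewrite thE (_ : 450 * K * y * (1 + tp) = 2 * K * tp * y + 256 * K * y + 192 * K * y +
    (2 * (K * y) + 448 * (K * y * tp))); last by ring.
  rewrite lerDl; apply: addr_ge0; apply: mulr_ge0; [exact: ler0n|exact: Ky|exact: ler0n|].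
  exact: mulr_ge0.
rewrite (_ : th * w * (1 + (4 * K1 + 450 * K) * y) =
  th * w + 4 * y * (K1 * (th * w)) + 450 * K * y * (th * w)); last by ring.
apply: le_trans (lerD (lexx _) h5); rewrite -!addrA.
apply: lerD => //; apply: lerD => //; apply: le_trans h6; rewrite -!addrA.
by apply: lerD => //; exact: lerD.
Qed.

(** Doubling x divides the target by 8. The conditional factor 1/16 uses up half of it, and [K1] is
    chosen so that the other half, K1/16 = 2K + 2/eta, is exactly the cost of the bad event and of
    the Markov term. *)
Lemma prob_recursion (K eta K1 th w w' x : R) : 0 < K -> 0 < eta -> 1 <= th -> 1 <= w ->
  w <= w' -> 1 <= x -> K1 = 2 * (16 * K + 16 / eta) ->
  2 * K / x ^+ 9 + th * w' / (eta / 2 * x ^+ 3) + 1 / 16 * (K1 * th * w / x ^+ 3)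
  <= K1 * th * w' / (2 * x) ^+ 3.
Proof.
move=> K0 e0 th1 w1 ww' x1 K1E.
have x0 : 0 < x by lra.
have x3 : 0 < x ^+ 3 by rewrite exprn_gt0.
rewrite exprMn -[leRHS]mulrA invfM mulrA -subr_ge0.
pose y := (x ^+ 6)^-1.
have y1 : y <= 1 by rewrite /y invf_le1 ?exprn_gt0// exprn_ege1.
rewrite (_ : _ - _ = (K1 * th * w' / 8 - 2 * K * y - 2 * (th * w') / eta - K1 * th * w / 16)
    / x ^+ 3); last by rewrite /y; field; rewrite !gt_eqF.
rewrite divr_ge0 ?(ltW x3)//.
have thw : 1 <= th * w' by rewrite mulr_ege1//; lra.
have h1 : K1 * th * w <= K1 * th * w'.
  rewrite ler_wpM2l//; apply: mulr_ge0; last by lra.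
  rewrite K1E; apply: mulr_ge0 => //; apply: addr_ge0.
    by apply: mulr_ge0; [exact: ler0n|exact: ltW].
  by apply: divr_ge0; [exact: ler0n|exact: ltW].
have h2 : 2 * K * y <= 2 * K * (th * w').
  by rewrite ler_wpM2l ?mulr_ge0 ?(ltW K0)//; lra.
have h3 : K1 * th * w' = 32 * K * (th * w') + 32 * (th * w' / eta).
  by rewrite K1E; field; rewrite gt_eqF.
lra.
Qed.

End scale_arithmetic.

(** * The multiscale recursion *)

(** The sum in parentheses starting with 1 bounds the first scale, and the exponential bounds the
    product of the growth factors over all scales. The factor 8 is the square root of the ratio 64
    of successive times, and the last term, the square root of the first time, covers smaller
    [n]. *)
Definition survival_const (R : realType) (K eta : R) (j0 : nat) : R :=
  let x := 2 ^+ j0 in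
  let N := (64 ^ j0)%N%:R in
  let K1 := 2 * (16 * K + 16 / eta) in
  8 * (K + K1 * ((1 + N * x + N * K + x ^+ 3 / K1) * expR (2 * (4 * K1 + 450 * K)))) + x ^+ 3.

Lemma survival_const_gt0 (R : realType) (K eta : R) j0 : 0 < K -> 0 < eta ->
  0 < survival_const K eta j0.
Proof.
move=> K0 eta0; rewrite /survival_const; cbv zeta.
set x := 2 ^+ j0; set N := (64 ^ j0)%N%:R; set K1 := 2 * (16 * K + 16 / eta).
have N0 : 0 <= N by exact: ler0n.
have x0 : 0 <= x by apply: exprn_ge0; exact: ler0n.
have K10 : 0 <= K1.
  rewrite /K1; apply: mulr_ge0; first exact: ler0n.
  by apply: addr_ge0; [apply: mulr_ge0 (ltW K0)|apply: divr_ge0 (ltW eta0)]; exact: ler0n.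
apply: ltr_wpDr; first exact: exprn_ge0.
apply: mulr_gt0; first exact: ltr0Sn.
apply: ltr_wpDr; last exact: K0.
apply: mulr_ge0; first exact: K10.
apply: mulr_ge0; last exact: expR_ge0.
apply: addr_ge0; last by apply: divr_ge0 => //; exact: exprn_ge0.
apply: addr_ge0; last exact: mulr_ge0 (ltW K0).
by apply: addr_ge0; [exact: ler01|exact: mulr_ge0].
Qed.

Section multiscale.
Variables (R : realType).
Variables (G : ptopologicalType) (mul : G -> G -> G) (one : G) (inv : G -> G).
Hypotheses (HG : topological_group mul one inv) (HGsp : sc_lc_space G).
Variables (mu : probability (borelT G) R).
Variables (P : probability (Omega G) R) (HP : is_product_measure mu P).
Variables (X : ptopologicalType) (act : G -> X -> X).
Hypotheses (Hact : continuous_action mul one act) (HXsp : sc_lc_space X).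
Variables (nu : probability (borelT X) R) (Hnu : stationary act mu nu).
Variables (sigma : G -> X -> R) (Hsigma : continuous_cocycle mul act sigma).
Hypothesis Hint : forall y, mu.-integrable setT (fun g => (sigma g y)%:E).
Hypothesis Hcent : centered mu sigma.

Local Notation U := (Omega G * borelT X)%type.
Local Notation Q := (P \x nu)%E.
Local Notation walk := (@walk R G mul one X sigma).
Local Notation Tit := (@Tit G mul one X act).

Variables (f : nat -> Omega G -> borelT X -> R).
Hypothesis mf : forall k, measurable_fun [set: Omega G * borelT X] (fun p => f k p.1 p.2).
Variables (alpha beta Bnd : R) (Halpha : 0 < alpha) (Hbeta : 0 < beta).
Hypothesis HC : forall k, (\int[nu]_x \int[P]_w (expR (alpha * `|f k w x|))%:E <= Bnd%:E)%E.
Hypothesis HD : forall k p : nat,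
  ((expR (beta * p%:R))%:E * (\int[nu]_x \int[P]_w
     (expR (alpha * `|f k w x - condexp_past P (fun w' => f k w' x) p w|))%:E - 1%E)
   <= Bnd%:E)%E.

Variables (K eta : R) (r0 : nat).
Hypotheses (K0 : 0 < K) (eta0 : 0 < eta).
Hypothesis Hkappa : forall x : R, 1 <= x ->
  (x ^+ 6 + 1) * bad_rate alpha beta Bnd x (8 * x)^-1 (x / 4) <= K / x ^+ 9.
Hypothesis Htau : forall x : R, 1 <= x -> forall y,
  (\int[mu]_g (tail x (sigma g y))%:E <= (K / x ^+ 9)%:E)%E.
Hypothesis Hconc : forall r x (a : R), (0 < r)%N -> (r0 <= r)%N ->
  (P [set w | (a <= Sx mul one sigma x r w <= a + eta * Num.sqrt r%:R)%R] <= (1 / 16)%:E)%E.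

Variable t : R.
Local Notation Z := (fun k u => t + walk k u).
Local Notation posmass A N := (\int[Q]_u (\1_A u * Num.max (Z N u) 0)%:E)%E.

Let x j : R := 2 ^+ j.
Let N j : nat := (64 ^ j)%N.
Let p j : nat := (2 ^ j)%N.
Let A j : set U := survive mul one P act sigma f t (p j) (N j) (x j)^-1.
Let B j : set U := bad mul one P act f (p j) (N j) (8 * x j)^-1 (x j / 4).
Let th : R := 1 + Num.max t 0.
Let K1 : R := 2 * (16 * K + 16 / eta).
Let D : R := 4 * K1 + 450 * K.

Let x_ge1 j : 1 <= x j.
Proof. by rewrite /x exprn_ege1// ler1n. Qed.

Let x_gt0 j : 0 < x j. Proof. exact: lt_le_trans (x_ge1 j). Qed.

Let xS j : x j.+1 = 2 * x j. Proof. by rewrite /x exprS. Qed.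

Let NE j : (N j)%:R = x j ^+ 6 :> R.
Proof. by rewrite /N /x natrX -exprM mulnC exprM; congr (_ ^+ j); rewrite -natrX. Qed.

Let pE j : (p j)%:R = x j :> R.
Proof. by rewrite /p /x natrX. Qed.

Let th1 : 1 <= th.
Proof. by rewrite /th lerDl le_max lexx orbT. Qed.

Let mA j : measurable (A j).
Proof. exact: (measurable_survive HG HGsp P Hact HXsp Hsigma mf). Qed.

Let mB j : measurable (B j).
Proof. exact: (measurable_bad HGsp P Hact HXsp mf). Qed.

Let QB j : (Q (B j) <= (K / x j ^+ 9)%:E)%E.
Proof.
have d0 : 0 < (8 * x j)^-1 by rewrite invr_gt0 mulr_gt0.
apply: le_trans (bad_le HG HGsp HP Hact HXsp Hnu mf Halpha HC HD (p j) (N j) (x j / 4) d0) _.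
by rewrite lee_fin pE -natr1 NE; exact: Hkappa.
Qed.

Let K10 : 0 < K1.
Proof.
rewrite /K1; apply: mulr_gt0; first exact: ltr0Sn.
by apply: addr_gt0; [apply: mulr_gt0 => //|apply: divr_gt0 => //]; exact: ltr0Sn.
Qed.

(** This is the hypothesis [A'sub] of the passage between scales, with the bad events of both scales
    united and the barrier L equal to twice x. *)
Let sub_step j u : (1 <= j)%N -> A j.+1 u -> (B j `|` B j.+1) u \/
  A j u /\ forall k, (N j + p j <= k <= N j.+1)%N -> - x j.+1 <= Z k u.
Proof.
move=> j1 Au; have xj := x_gt0 j; have y0 : 0 < (x j)^-1 by rewrite invr_gt0.
have x2 : 2 <= x j.
  by rewrite /x -[leLHS]expr1; apply: ler_weXn2l => //; rewrite ler1n.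
have NN : (N j <= N j.+1)%N by rewrite /N leq_exp2l.
(* In units of 1/x the left side is 1/2 + 1/4 + 1/8. *)
have s_le : (x j.+1)^-1 + 2 * (8 * x j)^-1 + 2 * (8 * x j.+1)^-1 <= (x j)^-1.
  by rewrite xS !invfM; lra.
have [|Aj] := survive_mono Hact (p j) (x j / 4) (x j.+1 / 4) NN s_le Au; first by left.
have [Bu|Zk] := survive_ge Hact (8 * x j.+1)^-1 (x j.+1 / 4) Au; first by left; right.
right; split => // k /andP[mk kN].
apply: le_trans (Zk k _); last first.
  by rewrite kN andbT (leq_trans _ mk)// addn_gt0 expn_gt0.
(* With x' for [x j.+1], the lower bound obtained is minus 5/(4x') + x'/2, and this sum is at most
   x'. *)
have : (x j.+1)^-1 <= 1 / 2 by rewrite -[1 / 2]invrK lef_pV2 ?posrE//; have := x_gt0 j.+1; rewrite ?xS; lra.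
rewrite lerN2 [(8 * _)^-1]invfM; have := x2; rewrite xS; lra.
Qed.

(** The number [w] carries both bounds at once and grows only by a factor 1 + D/x. The lower bounds
    on [j] ensure that enough steps remain for anticoncentration and that the barrier is small
    against the window. *)
Lemma scale_step j w : (1 <= j)%N -> (r0 <= N j)%N -> 4 / eta <= x j -> 1 <= w ->
  (posmass (A j) (N j) <= (th * w)%:E)%E -> (Q (A j) <= (K1 * th * w / x j ^+ 3)%:E)%E ->
  let w' := w * (1 + D / x j) in
  (posmass (A j.+1) (N j.+1) <= (th * w')%:E)%E /\
  (Q (A j.+1) <= (K1 * th * w' / x j.+1 ^+ 3)%:E)%E.
Proof.
move=> j1 r0j ej w1 HV HPa w'.
have xj := x_gt0 j; have x2 : 2 <= x j.
  by rewrite /x -[leLHS]expr1; apply: ler_weXn2l => //; rewrite ler1n.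
have aA : adapted (N j + p j) (A j) by exact: adapted_survive.
have pN : (p j <= N j)%N by rewrite /p /N leq_exp2r.
have NS : N j.+1 = (64 * N j)%N by rewrite /N expnS.
have NN : (N j + p j <= N j.+1)%N 
  by rewrite NS (leq_trans (leq_add (leqnn _) pN))// addnn -mul2n leq_mul2r orbT.
have mBB : measurable (B j `|` B j.+1) by exact: measurableU.
have QBB : (Q (B j `|` B j.+1) <= (2 * K / x j ^+ 9)%:E)%E.
  apply: (le_trans (measureU2 _ (mB j) (mB j.+1))).
  apply: le_trans (leeD (QB j) (QB j.+1)) _.
  rewrite -EFinD lee_fin -mulrA mulr_natl mulr2n lerD2l ler_pM2l// lef_pV2 ?posrE ?exprn_gt0//.
  by rewrite lerXn2r ?nnegrE ?(ltW (x_gt0 _))// xS; lra.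
have L0 : 0 <= x j.+1 by exact: ltW.
have tau0 : 0 <= K / x j.+1 ^+ 9 by rewrite divr_ge0 ?exprn_ge0// ltW.
have sub u := @sub_step j u j1.
have t0 : 0 <= Num.max t 0 by rewrite le_max lexx orbT.
have HV' : (posmass (A j.+1) (N j.+1) <= (th * w')%:E)%E.
  have := scale_mass HG HGsp HP Hact HXsp Hsigma L0 tau0 Hint Hcent (Htau (x_ge1 j.+1))
    (mA j) mBB aA NN sub HV HPa QBB.
  move=> /le_trans; apply; rewrite lee_fin NS !natrM NE pE xS.
  rewrite /w' [leRHS]mulrA; apply: le_trans (mass_recursion K0 (ltW K10) t0 (erefl th) w1 x2).
  apply: lerD => //; apply: ler_wpM2l.
    by apply: mulr_ge0; [exact: ler0n|apply: mulr_ge0; [exact: ler0n|rewrite exprn_ge0// ltW]].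
  by rewrite ler_pM2l// lef_pV2 ?posrE ?exprn_gt0 -?xS// lerXn2r ?nnegrE ?(ltW (x_gt0 _))// xS; lra.
split => //.
have h0 : 0 < eta / 2 * x j ^+ 3.
  by apply: mulr_gt0; [apply: divr_gt0 => //; exact: ltr0Sn|exact: exprn_gt0].
(* At least [N j] fresh steps remain, so sqrt r is at least x^3 and a window of width eta x^3 is
   admissible. *)
have rge : (N j <= N j.+1 - (N j + p j))%N.
  rewrite leq_subRL// NS addnAC (leq_trans (leq_add (leqnn _) pN))//.
  by rewrite addnn -mul2n -[X in (_ + X)%N]mul1n -mulnDl leq_mul2r orbT.
have N0 : (0 < N j)%N by rewrite /N expn_gt0.
have conc y b : (P [set v : Omega G | (b <= Sx mul one sigma y (N j.+1 - (N j + p j)) v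
    <= b + (x j.+1 + eta / 2 * x j ^+ 3))%R] <= (1 / 16)%:E)%E.
  apply: le_trans (Hconc y b (leq_trans N0 rge) (leq_trans r0j rge)).
  have mS := measurable_Sx HG HGsp Hact HXsp Hsigma (N j.+1 - (N j + p j)) y.
  apply: le_measure; rewrite ?inE; [exact: measurable_between|exact: measurable_between|].
  move=> v /= /andP[-> /le_trans]; apply; rewrite lerD2l.
  (* Half of this width is [h]; the other half contains the barrier 2x because 4/eta <= x <= x^2. *)
  apply: (@le_trans _ _ (eta * x j ^+ 3)).
    have : 2 * x j <= eta / 2 * x j ^+ 3; last by rewrite xS; lra.
    have -> : eta / 2 * x j ^+ 3 = eta / 2 * x j ^+ 2 * x j by ring.
    rewrite ler_pM2r//.
    have : 4 / eta <= x j ^+ 2 by apply: (le_trans ej); rewrite expr2 ler_peMl// ltW.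
    by rewrite ler_pdivrMr//; lra.
  rewrite ler_pM2l// -[leLHS]ger0_norm ?exprn_ge0 ?(ltW xj)// -sqrtr_sqr ler_wsqrtr//.
  by rewrite -exprM -NE ler_nat.
have := scale_prob HG HGsp HP Hact HXsp Hsigma (mA j) (mA j.+1) mBB aA NN sub HPa QBB h0 conc HV'.
move=> /le_trans; apply; rewrite lee_fin xS.
apply: prob_recursion => //.
rewrite ler_peMr ?(le_trans ler01 w1)// lerDl divr_ge0 ?(ltW xj)//.
rewrite /D; apply: addr_ge0; apply: mulr_ge0; (exact: ler0n || exact: ltW).
Qed.

Lemma survive_le j0 : (1 <= j0)%N -> (r0 <= N j0)%N -> 4 / eta <= x j0 ->
  forall j, (j0 <= j)%N ->
  (Q (A j) <= (K1 * th * ((1 + (N j0)%:R * x j0 + (N j0)%:R * K + x j0 ^+ 3 / K1) *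
                          expR (2 * D)) / x j ^+ 3)%:E)%E.
Proof.
move=> j01 r0j ej0; set wb : R := 1 + _ + _ + _.
have D0 : 0 <= D.
  by rewrite /D; apply: addr_ge0; apply: mulr_ge0; (exact: ler0n || exact: ltW).
have wb1 : 1 <= wb.
  by rewrite /wb -!addrA lerDl !addr_ge0 ?mulr_ge0 ?invr_ge0 ?exprn_ge0 ?(ltW K0) ?(ltW K10) ?(ltW (x_gt0 _)).
(* The exponent telescopes: from [j] to [j.+1] it grows by D/x_j, and 1 + D/x_j is at most the
   exponential of that. It never exceeds 2D. *)
pose w j : R := wb * expR (2 * D * ((x j0)^-1 - (x j)^-1)).
have main i : (posmass (A (j0 + i)%N) (N (j0 + i)%N) <= (th * w (j0 + i)%N)%:E)%E /\
   (Q (A (j0 + i)%N) <= (K1 * th * w (j0 + i)%N / x (j0 + i)%N ^+ 3)%:E)%E.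
  elim: i => [|i [IH1 IH2]].
    (* At the first scale the probability is bounded by 1. The terms of [wb] in [N j0] control the
       positive mass, and the last one makes the bound on the probability at least 1. *)
    rewrite addn0 /w subrr mulr0 expR0 mulr1; split.
      have QA1 : (Q (A j0) <= 1%:E)%E by exact: (@probability_le1 _ _ _ (Q : probability U R)).
      have L0 : 0 <= x j0 by exact: ltW.
      apply: le_trans (posmass_bad HG HGsp HP Hact HXsp Hsigma L0 (Htau (x_ge1 j0)) t
        (mA j0) QA1 (N j0)) _.
      rewrite lee_fin mulr1.
      have hK : (N j0)%:R * (K / x j0 ^+ 9) <= (N j0)%:R * K.
        by rewrite ler_wpM2l// ler_piMr ?(ltW K0)// invf_le1 ?exprn_gt0// exprn_ege1.
      have hx : 0 <= x j0 ^+ 3 / K1 by rewrite divr_ge0 ?exprn_ge0// ltW.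
      have ht : Num.max t 0 <= Num.max t 0 * wb by rewrite ler_peMr// le_max lexx orbT.
      rewrite /th mulrDl mul1r; move: ht hK hx; rewrite /wb; lra.
    apply: (@le_trans _ _ 1%E); first exact: (@probability_le1 _ _ _ (Q : probability U R)).
    rewrite lee_fin ler_pdivlMr ?exprn_gt0// mul1r.
    have hx : x j0 ^+ 3 <= K1 * wb.
      rewrite mulrC -ler_pdivrMr// /wb lerDr !addr_ge0 ?mulr_ge0//; exact: ltW.
    apply: (le_trans hx); have -> : K1 * th * wb = th * (K1 * wb) by ring.
    by rewrite ler_peMl// mulr_ge0 ?(ltW K10)// (le_trans ler01 wb1).
  rewrite addnS; set j := (j0 + i)%N in IH1 IH2 *.
  have jj : (j0 <= j)%N by rewrite leq_addr.
  have xle : x j0 <= x j by rewrite /x; apply: ler_weXn2l => //; rewrite ler1n.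
  have wj1 : 1 <= w j.
    rewrite mulr_ege1// -expR0 ler_expR mulr_ge0 ?mulr_ge0// subr_ge0 lef_pV2 ?posrE//.
  have ww : w j * (1 + D / x j) <= w j.+1.
    rewrite /w -mulrA ler_pM2l ?(lt_le_trans ltr01 wb1)//.
    have -> : 2 * D * ((x j0)^-1 - (x j.+1)^-1) = 2 * D * ((x j0)^-1 - (x j)^-1) + D / x j.
      by rewrite xS; field; rewrite !gt_eqF.
    by rewrite expRD ler_pM2l ?expR_gt0// expR_ge1Dx.
  have NN : (N j0 <= N j)%N by rewrite /N leq_exp2l.
  have [h1 h2] := scale_step (leq_trans j01 jj) (leq_trans r0j NN) (le_trans ej0 xle) wj1 IH1 IH2.
  split.
    by apply: le_trans h1 _; rewrite lee_fin ler_pM2l// (lt_le_trans ltr01 th1).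
  apply: le_trans h2 _; rewrite lee_fin ler_pM2r ?invr_gt0 ?exprn_gt0//.
  by rewrite ler_pM2l// mulr_gt0// (lt_le_trans ltr01 th1).
move=> j jj; have := (main (j - j0)%N).2; rewrite subnKC// => /le_trans; apply.
rewrite lee_fin ler_pM2r ?invr_gt0 ?exprn_gt0//.
rewrite ler_pM2l; last by rewrite mulr_gt0// (lt_le_trans ltr01 th1).
rewrite /w ler_pM2l ?(lt_le_trans ltr01 wb1)// ler_expR ler_piMr ?mulr_ge0//.
have : (x j0)^-1 <= 1 by rewrite invf_le1.
have : 0 <= (x j)^-1 by rewrite invr_ge0 ltW.
lra.
Qed.

Definition perturbed_survival (n : nat) : set U :=
  [set u | forall k, (1 <= k <= n)%N ->
     0 <= t + walk k u + value f k (Tit k u) - value f 0 u].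

Lemma measurable_perturbed_survival n : measurable (perturbed_survival n).
Proof.
rewrite (_ : perturbed_survival n = \bigcap_(k in [set k | (1 <= k <= n)%N])
    [set u | 0 <= t + walk k u + value f k (Tit k u) - value f 0 u]); last first.
  by apply/seteqP; split.
apply: bigcap_measurableType => k _; apply: measurable_le_fun.
apply: measurable_funB; last exact: mf.
apply: measurable_funD.
  apply: measurable_funD => //.
  exact: (measurable_walk HG HGsp Hact HXsp Hsigma).
apply: (measurableT_comp (mf k)).
exact: (measurable_Tit HGsp Hact HXsp).
Qed.

(** Survival up to [n] implies survival up to the largest scale time N_j below [n], hence [A j] or
    [B j]. Since [n] is less than 64 N_j, replacing sqrt N_j by sqrt n costs at most a factor 8. *)
Lemma perturbed_survival_le j0 : (1 <= j0)%N -> (r0 <= N j0)%N -> 4 / eta <= x j0 ->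
  forall n, (0 < n)%N ->
  (Q (perturbed_survival n) <= (survival_const K eta j0 * th / Num.sqrt n%:R)%:E)%E.
Proof.
move=> j01 r0j ej0 n n0.
have th0 : 0 <= th by rewrite (le_trans ler01 th1).
have mS := measurable_perturbed_survival n.
have sn0 : 0 < Num.sqrt n%:R :> R by rewrite sqrtr_gt0 ltr0n.
rewrite /survival_const -/(x j0) -/(N j0) -/K1 -/D; cbv zeta.
set W := (1 + _ + _ + _) * expR _.
have W0 : 0 <= W.
  by rewrite /W mulr_ge0 ?expR_ge0// !addr_ge0 ?mulr_ge0 ?invr_ge0 ?exprn_ge0 ?(ltW K0) ?(ltW K10).
have KW : 0 <= K + K1 * W := addr_ge0 (ltW K0) (mulr_ge0 (ltW K10) W0).
have KW0 : 0 <= 8 * (K + K1 * W) by apply: mulr_ge0 KW; exact: ler0n.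
have x30 j : 0 < x j ^+ 3 by rewrite exprn_gt0.
have sqrtN j : Num.sqrt (x j ^+ 6) = x j ^+ 3.
  by rewrite -[6%N]/(3 * 2)%N exprM sqrtr_sqr ger0_norm// ltW.
(* Before the first scale time, sqrt n is at most [x j0 ^+ 3], and the claimed bound is at least
   1. *)
have [Nn|nN] := leqP (N j0) n; last first.
  apply: (@le_trans _ _ 1%E); first exact: (@probability_le1 _ _ _ (Q : probability U R)).
  rewrite lee_fin ler_pdivlMr// mul1r.
  apply: (@le_trans _ _ (x j0 ^+ 3 * th)).
    apply: (@le_trans _ _ (x j0 ^+ 3)); last by rewrite ler_peMr// ltW.
    by rewrite -sqrtN ler_wsqrtr// -NE ler_nat ltnW.
  by rewrite ler_wpM2r// lerDr.
pose j := trunc_log 64 n.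
have j0j : (j0 <= j)%N by apply: trunc_log_max.
have /andP[jn nj] := trunc_log_bounds (isT : (1 < 64)%N) n0.
rewrite -/j -/(N j) -/(N j.+1) in jn nj.
have d_le : 2 * (8 * x j)^-1 <= (x j)^-1.
  have : 0 < (x j)^-1 by rewrite invr_gt0.
  by rewrite invfM; lra.
have cover : perturbed_survival n `<=` B j `|` A j.
  move=> u Su; apply: (survive_init P Hact (p j) (x j / 4) d_le) => k /andP[k1 kj].
  by apply: Su; rewrite k1 (leq_trans kj).
apply: (@le_trans _ _ (Q (B j `|` A j))).
  by apply: le_measure; rewrite ?inE//; exact: measurableU.
apply: (le_trans (measureU2 _ (mB j) (mA j))).
apply: le_trans (leeD (QB j) (survive_le j01 r0j ej0 j0j)) _.
rewrite -EFinD lee_fin -/W.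
have Kx : K / x j ^+ 9 <= K * th / x j ^+ 3.
  apply: ler_pM; rewrite ?invr_ge0 ?exprn_ge0 ?(ltW K0) ?(ltW (x_gt0 _))//.
    by rewrite ler_peMr// ltW.
  by rewrite lef_pV2 ?posrE ?exprn_gt0// ler_weXn2l.
have sn8 : Num.sqrt n%:R <= 8 * x j ^+ 3.
  have -> : 8 * x j ^+ 3 = x j.+1 ^+ 3 by rewrite xS exprMn; congr (_ * _); ring.
  by rewrite -sqrtN ler_wsqrtr// -NE ler_nat ltnW.
apply: (@le_trans _ _ (8 * (K + K1 * W) * th / Num.sqrt n%:R)); last first.
  by rewrite ler_pM2r ?invr_gt0// ler_wpM2r// lerDl ltW.
apply: (@le_trans _ _ ((K + K1 * W) * th / x j ^+ 3)).
  rewrite (_ : (K + K1 * W) * th / x j ^+ 3 = K * th / x j ^+ 3 + K1 * th * W / x j ^+ 3).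
    by rewrite lerD2r.
  by field; rewrite gt_eqF.
rewrite ler_pdivlMr// mulrAC ler_pdivrMr//.
have C0 : 0 <= (K + K1 * W) * th := mulr_ge0 KW th0.
have := ler_wpM2l C0 sn8; lra.
Qed.

End multiscale.

(** * Choice of the constants *)

Unset Implicit Arguments.

Theorem theoremA2 (R : realType)
  (* the group G, with Borel probability mu *)
  (G : ptopologicalType) (mul : G -> G -> G) (one : G) (inv : G -> G)
  (HG : topological_group mul one inv) (HGsp : sc_lc_space G)
  (mu : probability (borelT G) R)
  (* Omega = G^{N*}, P = mu^{(x) N*} *)
  (P : probability (Omega G) R) (HP : is_product_measure mu P)
  (* the G-space X with mu-stationary nu *)
  (X : ptopologicalType) (act : G -> X -> X)
  (Hact : continuous_action mul one act) (HXsp : sc_lc_space X)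
  (nu : probability (borelT X) R) (Hnu : stationary act mu nu)
  (* the cocycle *)
  (sigma : G -> X -> R) (Hsigma : continuous_cocycle mul act sigma)
  (Hexp : exp_moment mu sigma) (Hcent : centered mu sigma)
  (* strong approximation property, on an enlarged probability space *)
  (dE : measure_display) (E : measurableType dE) (PE : probability E R)
  (pi : E -> Omega G) (Hpi : measurable_fun [set: E] pi)
  (Hpi_law : forall A : set (Omega G), measurable A -> PE (pi @^-1` A) = P A)
  (W : E -> R -> R) (HW : is_wiener PE W) (v : R) (Hv : 0 < v)
  (Hsap : forall eps : R, 0 < eps < 4^-1 ->
     exists c_eps : R, forall (x : X) (n : nat), (0 < n)%N ->
       (PE [set e | (exists s : R, 0 <= s <= 1 /\
             n%:R `^ (2^-1 - eps) <
             `| Sx mul one sigma x (Num.truncn (n%:R * s)) (pi e)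
                - v * W e (n%:R * s) |)%R]
       <= (c_eps * n%:R `^ (- eps))%:E)%E)
  (alpha beta Bnd : R) (Halpha : 0 < alpha) (Hbeta : 0 < beta) (HB : 1 <= Bnd) :
  exists c : R, 0 < c /\
    forall (t : R) (n : nat) (f : nat -> Omega G -> borelT X -> R),
      (0 < n)%N ->
      (forall k, measurable_fun [set: Omega G * borelT X]
                   (fun p => f k p.1 p.2)) ->
      (* C_alpha(f) <= B *)
      (forall k, (\int[nu]_x \int[P]_w (expR (alpha * `|f k w x|))%:E
                  <= Bnd%:E)%E) ->
      (* D_{alpha,beta}(f) <= B *)
      (forall k p : nat,
         ((expR (beta * p%:R))%:E *
          (\int[nu]_x \int[P]_w
             (expR (alpha * `|f k w x - condexp_past P (fun w' => f k w' x) p w|))%:E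
           - 1%E) <= Bnd%:E)%E) ->
      (\int[nu]_x P (tau_gt mul one act sigma f x t n)
         <= (c * (1 + Num.max t 0) / Num.sqrt n%:R)%:E)%E.
Proof.
have msig y : measurable_fun [set: borelT G] (fun g => sigma g y).
  exact: (measurableT_comp (measurable_sigma HGsp HXsp Hsigma) (pair2_measurable (y : borelT X))).
have [a [M [a0 M0 HM]]] := exp_moment_unif Hexp.
have Hint := exp_moment_integrable msig a0 HM.
(* The indices 15, 14 and 8 give the powers 16, 15 and 9. The number of times is of order x^6 and
   the tolerance 1/(8x) costs one more power, so that each of the three contributions ends up as
   x^(-9). *)
have [C1 C10 HC1] := expR_decay 15 Hbeta.
have a4 : 0 < alpha / 4 by rewrite divr_gt0.
have [C2 C20 HC2] := expR_decay 14 a4.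
have a2 : 0 < a / 2 by rewrite divr_gt0.
have [C3 C30 HC3] := expR_decay 8 a2.
have B0 : 0 < Bnd by apply: lt_le_trans HB.
pose T := 2 / a * M * C3.
have T0 : 0 <= T by rewrite !mulr_ge0 ?invr_ge0 ?(ltW a0) ?(ltW C30).
pose T' := 16 * Bnd * C1 / alpha + 2 * Bnd * C2.
have T'0 : 0 < T' by rewrite addr_gt0 ?divr_gt0 ?mulr_gt0.
pose K := T' + T.
have K0 : 0 < K by rewrite ltr_wpDr.
have Hkappa (x : R) : 1 <= x ->
    (x ^+ 6 + 1) * bad_rate alpha beta Bnd x (8 * x)^-1 (x / 4) <= K / x ^+ 9.
  move=> x1; have x0 : 0 < x by lra.
  apply: (@le_trans _ _ (T' / x ^+ 9)); last first.
    by rewrite ler_pM2r ?invr_gt0 ?exprn_gt0// lerDl.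
  have -> : T' / x ^+ 9 = 2 * x ^+ 6 * (Bnd * (C1 / x ^+ 16) / (alpha * (8 * x)^-1)
      + Bnd * (C2 / x ^+ 15)).
    by rewrite /T'; field; rewrite !gt_eqF.
  have dx : 0 < alpha * (8 * x)^-1 by rewrite mulr_gt0 ?invr_gt0 ?mulr_gt0.
  rewrite /bad_rate; apply: ler_pM.
  - by rewrite addr_ge0// exprn_ge0// ltW.
  - apply: addr_ge0; last by rewrite mulr_ge0 ?expR_ge0 ?(ltW B0).
    by apply: divr_ge0 (ltW dx); rewrite mulr_ge0 ?expR_ge0 ?(ltW B0).
  - by have := exprn_ege1 6 x1; lra.
  apply: lerD.
    rewrite ler_pM2r ?invr_gt0// ler_pM2l//; exact: HC1.
  rewrite ler_pM2l// (_ : - alpha * (x / 4) = - (alpha / 4) * x); last by field.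
  exact: HC2.
have Htau (x : R) : 1 <= x -> forall y,
    (\int[mu]_g (tail x (sigma g y))%:E <= (K / x ^+ 9)%:E)%E.
  move=> x1 y; have x0 : 0 < x by lra.
  apply: le_trans (exp_moment_tail msig a0 HM x y) _; rewrite lee_fin.
  apply: (@le_trans _ _ (T / x ^+ 9)); last first.
    by rewrite ler_pM2r ?invr_gt0 ?exprn_gt0// lerDr ltW.
  by rewrite /T -[leRHS]mulrA ler_wpM2l ?HC3// !mulr_ge0 ?invr_ge0 ?(ltW a0).
have q0 : 0 < 1 / 16 :> R by rewrite divr_gt0.
have [eta eta0 [r0 Hconc]] :=
  anticoncentration HG HGsp Hact HXsp Hsigma Hpi Hpi_law HW Hv Hsap q0.
(* As 2^j and 64^j both exceed j, this first scale satisfies the requirements on [eta] and on [r0]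
   simultaneously. *)
pose j0 := (Num.truncn (4 / eta) + r0).+1.
have j0x : (j0%:R : R) <= 2 ^+ j0 by rewrite -natrX ler_nat ltnW// ltn_expl.
have ej0 : 4 / eta <= 2 ^+ j0.
  apply: le_trans j0x; apply: (le_trans (ltW (truncnS_gt _))).
  by rewrite ler_nat ltnS leq_addr.
have r0j : (r0 <= 64 ^ j0)%N.
  apply: leq_trans (ltnW (ltn_expl j0 (isT : (1 < 64)%N))).
  by rewrite /j0 ltnW// ltnS leq_addl.
(* [K], [eta] and [j0] were fixed before [t], [n] and [f] are introduced, which gives the
   uniformity. *)
exists (survival_const K eta j0); split.
  exact: survival_const_gt0.
move=> t n f n0 mf HC HD.
have := perturbed_survival_le HG HGsp HP Hact HXsp Hnu Hsigma Hint Hcent mf Halpha HC HD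
  K0 eta0 Hkappa Htau Hconc t (isT : (1 <= j0)%N) r0j ej0 n0.
apply: le_trans.
(* The section of [perturbed_survival] at a starting point is [tau_gt] by unfolding. *)
rewrite product_measure_ysection//.
exact: (measurable_perturbed_survival HG HGsp Hact HXsp Hsigma mf).
Qed.
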